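(* Let $\Omega$ be a domain in a separable complex Banach space $X$. Let $Z$ be a separable complex Banach space with a countable Schauder basis, and let $Y = Z^*$ be its dual Banach space. Let $W$ be a bounded domain in $Y$, and let $\mathcal{O}(\Omega, W)$ be the set of all holomorphic mappings $\Omega \to Y$ with values in $W$. Then the compact-weak*-open topology is a Montel topology, in the sense that the family $\mathcal{O}(\Omega, W)$ is normal with respect to the compact-weak*-open topology: every sequence in $\mathcal{O}(\Omega, W)$ has a subsequence that converges, in the compact-weak*-open topology on $\mathcal{O}(\Omega, Y)$, to an element of $\mathcal{O}(\Omega, Y)$.
   Context: A domain is a connected open set. For a mapping $u : \Omega \to Y$, $q \in \Omega$ and $v \in X$, put $du(q;v) = \lim_{\mathbb{R} \ni \epsilon \to 0} \frac{u(q+\epsilon v) - u(q)}{\epsilon}$ and $\overline{D}u(q;v) = \frac{1}{2}\big(du(q;v) + i\, du(q; iv)\big)$. The mapping $u$ is $C^1$ if $du(q;v)$ exists for all $q \in \Omega$, $v \in X$ and $(q,v) \mapsto du(q;v)$ is continuous; a $C^1$ mapping $u$ is holomorphic if $\overline{D}u \equiv 0$ on $\Omega$. Here $Y$ carries its norm topology. $\mathcal{O}(\Omega, Y)$ denotes the set of all holomorphic mappings from $\Omega$ into $Y$. The compact-weak*-open topology on $\mathcal{O}(\Omega, Y)$ is the topology generated by the sub-basic open sets $G(K,U) = \{ f \in \mathcal{O}(\Omega, Y) : f(K) \subset U \}$, where $K$ is a compact subset of $\Omega$ and $U$ is a weak-* open subset of $Y = Z^*$. *)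

(* Defs.v *)
From HB Require Import structures.
From mathcomp Require Import all_boot all_order all_algebra.
From mathcomp Require Import all_classical all_reals all_analysis.
From mathcomp Require Import complex.

Set Implicit Arguments.
Unset Strict Implicit.
Unset Printing Implicit Defensive.

Import Order.TTheory GRing.Theory Num.Theory.
Import numFieldNormedType.Exports.

Local Open Scope classical_set_scope.
Local Open Scope ring_scope.
Local Open Scope complex_scope.

Definition is_domain {T : topologicalType} (A : set T) : Prop :=
  open A /\ connected A.

Definition separable_space (T : topologicalType) : Prop :=
  exists2 D : set T, countable D & dense D.

(* The basis vectors are the [b n] with [n] in [I], taken in increasing order
   of [n]; a finite [I] gives a basis of a finite-dimensional space. *)
Definition schauder_basis (R : realType) (Z : normedModType R[i])
    (I : set nat) (b : nat -> Z) : Prop :=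
  forall z : Z, exists! a : nat -> R[i],
    (forall n, ~ I n -> a n = 0) /\ series (fun n => a n *: b n) @ \oo --> z.

Definition has_schauder_basis (R : realType) (Z : normedModType R[i]) : Prop :=
  exists (I : set nat) (b : nat -> Z), schauder_basis I b.

Section dual.
Context {R : realType} (Z : normedModType R[i]).

Definition dual_pred : {pred Z -> R[i]^o} :=
  [pred f : Z -> R[i]^o | `[< linear f /\ continuous f >]].

Record dual : Type :=
  Dual { dual_fun :> Z -> R[i]^o ; _ : dual_fun \in dual_pred }.

HB.instance Definition _ := [isSub for dual_fun].
HB.instance Definition _ := [Choice of dual by <:].

Fact dual_pred_submod : submod_closed dual_pred.
Proof.
split.
  apply/asboolP; split => [a x y|]; last exact: cst_continuous.
  by rewrite /= scaler0 addr0.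
move=> a f g /asboolP[lf cf] /asboolP[lg cg]; apply/asboolP; split.
  move=> k x y /=; rewrite !fctE lf lg !scalerDr addrACA.
  by rewrite !scalerA mulrC.
move=> x; apply: (@continuousD _ _ _ (a \*: f) g); last exact: cg.
by apply: continuousZr; exact: cf.
Qed.

HB.instance Definition _ :=
  GRing.isSubmodClosed.Build R[i] (Z -> R[i]^o) dual_pred dual_pred_submod.
HB.instance Definition _ := [SubChoice_isSubLmodule of dual by <:].

(* Norms on a normed module over [R[i]] take values in [R[i]]; [complex.Re]
   recovers the real number, so that the supremum is taken in [R]. *)
Definition opnorm (f : dual) : R :=
  sup [set complex.Re `|f z| | z in [set z : Z | `|z| <= 1]].

Fact dual_linear (f : dual) : linear f.
Proof. by case: f => f /= /asboolP[]. Qed.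

Fact dual_continuous (f : dual) : continuous f.
Proof. by case: f => f /= /asboolP[]. Qed.

HB.instance Definition _ (f : dual) :=
  GRing.isLinear.Build R[i] Z R[i]^o *:%R f (dual_linear f).

Let normCE (c : R[i]) : (complex.Re `|c|)%:C = `|c|.
Proof. by apply/RRe_real/ger0_real. Qed.

Let opnorm_has_sup (f : dual) :
  has_sup [set complex.Re `|f z| | z in [set z : Z | `|z| <= 1]].
Proof.
split; first by exists (complex.Re `|f 0|), 0 => //=; rewrite normr0.
have /linear_boundedP : bounded_near f (nbhs (0 : Z)).
  by apply/linear_bounded_continuous/dual_continuous.
move=> /pinfty_ex_gt0[M M0 fM].
exists (complex.Re M) => _ [z /= z1 <-].
rewrite -lecR normCE RRe_real ?gtr0_real//.
by rewrite (le_trans (fM z))// ler_piMr// ltW.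
Qed.

Fact le_opnorm (f : dual) (z : Z) : `|f z| <= (opnorm f)%:C * `|z|.
Proof.
have [->|z0] := eqVneq z 0; first by rewrite linear0 !normr0 mulr0.
have nz0 : 0 < `|z| by rewrite normr_gt0.
rewrite -ler_pdivrMr//.
have -> : `|f z| / `|z| = `|f (`|z|^-1 *: z)|.
  by rewrite linearZ/= normrZ normfV normr_id mulrC.
rewrite -normCE lecR; apply: (ub_le_sup (opnorm_has_sup f).2).
by exists (`|z|^-1 *: z) => //=; rewrite normrZ normfV normr_id mulVf// gt_eqF.
Qed.

Fact opnorm_le (f : dual) (M : R) :
  (forall z : Z, `|z| <= 1 -> `|f z| <= M%:C) -> opnorm f <= M.
Proof.
move=> fM; apply: ge_sup; first exact: (opnorm_has_sup f).1.
by move=> _ [z /= z1 <-]; rewrite -lecR normCE fM.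
Qed.

Fact opnorm_ge0 (f : dual) : 0 <= opnorm f.
Proof.
apply: (ub_le_sup (opnorm_has_sup f).2).
by exists 0; [rewrite /= normr0|rewrite linear0 normr0].
Qed.

Let le_opnorm1 (f : dual) (z : Z) : `|z| <= 1 -> `|f z| <= (opnorm f)%:C.
Proof.
move=> z1; rewrite (le_trans (le_opnorm f z))// ler_piMr//.
by rewrite lecR opnorm_ge0.
Qed.

Fact opnormD (f g : dual) :
  (opnorm (f + g))%:C <= (opnorm f)%:C + (opnorm g)%:C.
Proof.
rewrite -rmorphD lecR; apply: opnorm_le => z z1; rewrite rmorphD/=.
by rewrite (le_trans (ler_normD _ _))// lerD// le_opnorm1.
Qed.

Fact opnorm_eq0 (f : dual) : (opnorm f)%:C = 0 -> f = 0.
Proof.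
move=> f0; apply/val_inj/funext => z /=.
by apply/eqP; rewrite -normr_le0 (le_trans (le_opnorm f z))// f0 mul0r.
Qed.

Let opnormZ_le (a : R[i]) (f : dual) :
  (opnorm (a *: f))%:C <= `|a| * (opnorm f)%:C.
Proof.
rewrite -(normCE a) -rmorphM lecR; apply: opnorm_le => z z1.
by rewrite rmorphM/= normCE normrM ler_wpM2l// le_opnorm1.
Qed.

Fact opnormZ (a : R[i]) (f : dual) :
  (opnorm (a *: f))%:C = `|a| * (opnorm f)%:C.
Proof.
apply/eqP; rewrite eq_le opnormZ_le/=.
have [->|a0] := eqVneq a 0; first by rewrite normr0 mul0r lecR opnorm_ge0.
rewrite -ler_pdivlMl ?normr_gt0// -normfV.
by apply: le_trans (opnormZ_le _ _); rewrite scalerA mulVf// scale1r.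
Qed.

HB.instance Definition _ :=
  Lmodule_isNormed.Build R[i] dual opnormD opnormZ opnorm_eq0.

End dual.

(* [weakstar Z] is [dual Z] with the coarsest topology making all evaluations
   [f |-> f z] continuous. *)
Definition weakstar (R : realType) (Z : normedModType R[i]) : Type := dual Z.

Section weakstar.
Context {R : realType} (Z : normedModType R[i]).

HB.instance Definition _ := Choice.on (weakstar Z).
HB.instance Definition _ := isSubBaseTopological.Build (weakstar Z)
  [set G : set (weakstar Z) | exists (z : Z) (V : set R[i]^o),
    open V /\ G = [set f : dual Z | V (f z)]] id.

End weakstar.

Section holomorphic.
Context {R : realType} {X Y : normedModType R[i]}.
Implicit Types (u : X -> Y) (Omega : set X).

Definition diff_quotient u (q v : X) (e : R) : Y :=
  (e%:C)^-1 *: (u (q + e%:C *: v) - u q).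

Definition du u (q v : X) : Y := lim (diff_quotient u q v e @[e --> (0 : R)^']).

Definition Dbar u (q v : X) : Y :=
  2^-1 *: (du u q v + 'i%C *: du u q ('i%C *: v)).

Definition C1 Omega u : Prop :=
  (forall q v, Omega q -> cvg (diff_quotient u q v e @[e --> (0 : R)^'])) /\
  {within Omega `*` [set: X], continuous (fun qv : X * X => du u qv.1 qv.2)}.

Definition holomorphic Omega u : Prop :=
  C1 Omega u /\ forall q v, Omega q -> Dbar u q v = 0.

(* A mapping on [Omega] is represented by its extension by zero to [X], so that
   two elements of [holo Omega] agreeing on [Omega] are equal. *)
Record holo Omega : Type := Holo {
  holo_fun :> X -> Y ;
  _ : holomorphic Omega holo_fun ;
  _ : forall x, ~ Omega x -> holo_fun x = 0
}.

HB.instance Definition _ Omega := gen_eqMixin (holo Omega).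
HB.instance Definition _ Omega := gen_choiceMixin (holo Omega).

End holomorphic.
Arguments holo {R X} Y Omega.

(* O(Omega, Z^* ) with its compact-weak*-open topology. *)
Definition cwso (R : realType) (X Z : normedModType R[i]) (Omega : set X)
  : Type := holo (dual Z) Omega.
Arguments cwso {R X} Z Omega.

Section cwso.
Context {R : realType} {X : normedModType R[i]}.
Variables (Z : normedModType R[i]) (Omega : set X).

HB.instance Definition _ := Choice.on (cwso Z Omega).
HB.instance Definition _ := isSubBaseTopological.Build (cwso Z Omega)
  [set G : set (cwso Z Omega) | exists (K : set X) (U : set (weakstar Z)),
    [/\ compact K, K `<=` Omega, open U &
        G = [set f : holo (dual Z) Omega | f @` K `<=` U]]] id.

Definition holo_into (W : set (dual Z)) : set (cwso Z Omega) :=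
  [set f : holo (dual Z) Omega | f @` Omega `<=` W].

End cwso.
Arguments holo_into {R X Z} Omega W.

Definition normal_family (T : topologicalType) (F : set T) : Prop :=
  forall u : nat -> T, (forall n, F (u n)) ->
    exists phi : nat -> nat, {homo phi : m n / (m < n)%N} /\
      exists f : T, u (phi n) @[n --> \oo] --> f.

(* Main.v *)
(** Montel's theorem by an ultrafilter and equicontinuity.

    On a complex line, evaluating a holomorphic map at a vector of [Z] gives a
    scalar function satisfying Cauchy's formula, hence first and second order
    estimates that depend only on a bound of the map.  Such estimates are
    closed under pointwise weak* limits.  Along an ultrafilter finer than
    [\oo] a bounded sequence [u n] and its differentials converge pointwise
    weak* (Banach-Alaoglu), and by the estimates the limit [f] is holomorphic
    for the norm topology.  A subsequence converges to [f] on countable dense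
    subsets of [X] and [Z], thus everywhere by equicontinuity, and jointly in
    the point and the index, which gives uniformity on compact sets.

    Cauchy's formula is obtained without integrals: the Riemann sums over the
    [N]-th roots of unity are controlled by telescoping, using only uniform
    differentiability on the disc. *)

From HB Require Import structures.
Require Import Defs.
From mathcomp Require Import all_boot all_order all_algebra.
From mathcomp Require Import all_classical all_reals all_analysis.
From mathcomp Require Import complex.
From mathcomp Require Import ring lra.

Set Implicit Arguments.
Unset Strict Implicit.
Unset Printing Implicit Defensive.

Import Order.TTheory GRing.Theory Num.Theory.
Import numFieldNormedType.Exports.

Local Open Scope classical_set_scope.
Local Open Scope ring_scope.
Local Open Scope complex_scope.

(** * Cauchy's formula on roots of unity *)

(* Contract the nodes towards [w] by a factor [t]: the [t]-derivative of the
   contracted sum is [\sum_k D (p t k) * u k], whose terms are, up to the common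
   factor [t * (om - 1)], increments of [g] from one node to the next, so it
   nearly telescopes to 0, and the contracted sum vanishes at [t = 0]. *)
Lemma discrete_cauchy_estimate (C : numFieldType) (g D : C -> C)
    (r w om e d : C) (N m : nat) :
  0 < r -> `|w| < r -> `|om| = 1 -> om ^+ N = 1 -> om != 1 -> (0 < m)%N ->
  (forall a b, `|a| <= r -> `|b| <= r -> `|a - b| < d ->
    `|g a - g b - D b * (a - b)| <= e * `|a - b|) ->
  r * `|om - 1| < d -> 2 * r / m%:R < d ->
  `|\sum_(0 <= k < N)
     (g (r * om ^+ k) - g w) * (r * om ^+ k / (r * om ^+ k - w))|
    <= 2 * N%:R * e * r.
Proof.
move=> r0 wr om1 omN omn1 m0 gD romd rmd.
pose u k := r * om ^+ k; pose p t k := w + t * (u k - w).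
have nu k : `|u k| = r by rewrite normrM normrX om1 expr1n mulr1 gtr0_norm.
have uw k : u k - w != 0.
  by apply/eqP => /subr0_eq uw; move: wr; rewrite -uw nu ltxx.
have np t k : 0 <= t -> t <= 1 -> `|p t k| <= r.
  move=> t0 t1; have -> : p t k = (1 - t) * w + t * u k by rewrite /p; ring.
  rewrite (le_trans (ler_normD _ _))// 2!normrM nu (ger0_norm t0).
  rewrite ger0_norm ?subr_ge0//.
  have -> : (1 - t) * `|w| + t * r = r - (1 - t) * (r - `|w|) by ring.
  by rewrite gerBl mulr_ge0 ?subr_ge0// ltW.
have sD t : 0 <= t -> t <= 1 ->
    `|\sum_(0 <= k < N) D (p t k) * u k| <= N%:R * e * r.
  move=> t0 t1; have [->|tn0] := eqVneq t 0.
    have -> : \sum_(0 <= k < N) D (p 0 k) * u k =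
              D w * r * \sum_(0 <= k < N) om ^+ k.
      rewrite mulr_sumr; apply: eq_bigr => k _.
      by rewrite /p mul0r addr0 mulrA.
    have : (om - 1) * \sum_(0 <= k < N) om ^+ k = 0.
      by rewrite big_mkord -subrX1 omN subrr.
    move/eqP; rewrite mulf_eq0 subr_eq0 (negbTE omn1)/= => /eqP ->.
    rewrite mulr0 normr0 mulr_ge0 ?(ltW r0)// mulr_ge0//.
    (* Nonnegativity of [e] is not assumed: it follows from [gD] at the distinct nodes [r] and
       [r * om]. *)
    have := gD r (r * om).
    have -> : `|r - r * om| = r * `|om - 1|.
      by rewrite -{1}(mulr1 r) -mulrBr normrM distrC gtr0_norm.
    rewrite normrM om1 mulr1 gtr0_norm// lexx => /(_ isT isT romd) ge.
    have := le_trans (normr_ge0 _) ge.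
    by rewrite pmulr_lge0// pmulr_rgt0// normr_gt0 subr_eq0.

  have tgt : 0 < t by rewrite lt_def tn0.
  have pp k : p t k.+1 - p t k = t * (om - 1) * u k.
    by rewrite /p /u exprS; ring.
  have npp k : `|p t k.+1 - p t k| = t * (r * `|om - 1|).
    by rewrite pp 2!normrM nu (ger0_norm t0); ring.
  have rom0 : 0 < t * (r * `|om - 1|).
    by rewrite !mulr_gt0// normr_gt0 subr_eq0.
  rewrite -(ler_pM2r rom0).
  have -> : `|\sum_(0 <= k < N) D (p t k) * u k| * (t * (r * `|om - 1|)) =
     r * `|\sum_(0 <= k < N) D (p t k) * (p t k.+1 - p t k)|.
    under [in RHS]eq_bigr do rewrite pp mulrCA.
    by rewrite -mulr_sumr !normrM (ger0_norm t0); ring.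
  have -> : N%:R * e * r * (t * (r * `|om - 1|)) =
            r * (\sum_(0 <= k < N) (e * (t * (r * `|om - 1|)))).
    by rewrite sumr_const_nat subn0 -[_ *+ N]mulr_natl; ring.
  rewrite ler_pM2l//.
  (* The increments of [g] sum to 0 because [om ^+ N = 1] closes the polygon; only the linearization
     errors remain. *)
  have -> : \sum_(0 <= k < N) D (p t k) * (p t k.+1 - p t k) =
      - \sum_(0 <= k < N)
          (g (p t k.+1) - g (p t k) - D (p t k) * (p t k.+1 - p t k)).
    rewrite sumrB telescope_sumr// /p /u omN expr0 subrr sub0r opprK.
    by apply: eq_bigr.
  rewrite normrN (le_trans (ler_norm_sum _ _ _))//.
  apply: ler_sum => k _; rewrite -(npp k); apply: gD; rewrite ?np// npp.
  by rewrite (le_lt_trans _ romd)// ler_piMl// mulr_ge0// ltW.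
pose S t := \sum_(0 <= k < N) (g (p t k) - g w) * (u k / (u k - w)).
have mgt : 0 < (m%:R : C) by rewrite ltr0n.
(* The path from [t = 0] to [t = 1] is cut into [m] steps. Each step costs [m^-1 * (2 * N * e * r)]:
   one half from linearizing [g], the other from [sD]. *)
suff Sj j : (j <= m)%N -> `|S (j%:R / m%:R)| <= j%:R / m%:R * (2 * N%:R * e * r).
  have := Sj m (leqnn _); rewrite divff ?gt_eqF// mul1r; apply: le_trans.
  rewrite le_eqVlt; apply/orP; left; apply/eqP; congr `|_|.
  by apply: eq_bigr => k _; have -> : p 1 k = u k by rewrite /p; ring.
elim: j => [_|j IH jm].
  rewrite !mul0r /S big1 ?normr0// => k _.
  by rewrite /p mul0r addr0 subrr mul0r.
have /IH {}IH := ltnW jm.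
set t := j%:R / m%:R in IH *.
have t0 : 0 <= t by rewrite divr_ge0.
have t1 : t <= 1 by rewrite ler_pdivrMr// mul1r ler_nat ltnW.
pose t' := j.+1%:R / m%:R : C.
have t'0 : 0 <= t' by rewrite divr_ge0.
have t'1 : t' <= 1 by rewrite ler_pdivrMr// mul1r ler_nat.
have tt' : t' = t + m%:R^-1 by rewrite /t' /t -natr1 mulrDl mul1r.
rewrite -/t'; have -> : S t' = (S t' - S t) + S t by rewrite subrK.
rewrite (le_trans (ler_normD _ _))//.
rewrite {2}tt' [X in _ <= X]mulrDl [X in _ <= X]addrC lerD//.
(* The weight [u k / (u k - w)] is made for this: it cancels the factor [u k - w] of
   [p t' k - p t k]. *)
have -> : S t' - S t = (\sum_(0 <= k < N)
     (g (p t' k) - g (p t k) - D (p t k) * (p t' k - p t k))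
        * (u k / (u k - w)))
   + m%:R^-1 * \sum_(0 <= k < N) D (p t k) * u k.
  rewrite /S -sumrB mulr_sumr -big_split/=; apply: eq_bigr => k _.
  have -> : p t' k - p t k = m%:R^-1 * (u k - w) by rewrite /p tt'; ring.
  by field; rewrite uw gt_eqF.
rewrite (le_trans (ler_normD _ _))//.
have -> : m%:R^-1 * (2 * N%:R * e * r) =
   \sum_(0 <= k < N) m%:R^-1 * e * r + m%:R^-1 * (N%:R * e * r).
  by rewrite sumr_const_nat subn0 -[_ *+ N]mulr_natl; ring.
rewrite lerD//; last first.
  by rewrite normrM ger0_norm ?invr_ge0// ler_pM2l ?invr_gt0// sD.
rewrite (le_trans (ler_norm_sum _ _ _))//; apply: ler_sum => k _.
have ppk : `|p t' k - p t k| = `|u k - w| / m%:R.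
  have -> : p t' k - p t k = m%:R^-1 * (u k - w) by rewrite /p tt'; ring.
  by rewrite normrM ger0_norm ?invr_ge0// mulrC.
have : `|p t' k - p t k| < d.
  rewrite ppk; apply: le_lt_trans rmd; rewrite ler_pM2r ?invr_gt0//.
  by rewrite (le_trans (ler_normB _ _))// nu mulr_natl mulr2n lerD// ltW.
move/(gD _ _ (np _ _ t'0 t'1) (np _ _ t0 t1)); rewrite ppk => gb.
rewrite normrM [X in _ * X]normrM normfV nu.
have uw0 : 0 < `|u k - w| by rewrite normr_gt0.
have -> : m%:R^-1 * e * r = e * (`|u k - w| / m%:R) * (r / `|u k - w|).
  by field; rewrite !gt_eqF.
by rewrite ler_wpM2r// divr_ge0// ltW.
Qed.

Lemma normc_real (R : rcfType) (x : R) : `|x%:C| = `|x|%:C.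
Proof. by rewrite normc_def/= expr0n/= addr0 sqrtr_sqr. Qed.

Lemma normc_i (R : rcfType) : `|'i%C : R[i]| = 1.
Proof. by rewrite normc_def/= expr0n/= add0r expr1n sqrtr1. Qed.

Lemma gt0_complexP (R : rcfType) (e : R[i]) :
  0 < e -> exists2 e' : R, 0 < e' & e = e'%:C.
Proof.
by move=> e0; exists (complex.Re e); [rewrite -ltcR|]; rewrite RRe_real ?gtr0_real.
Qed.

Lemma ge0_complexP (R : rcfType) (e : R[i]) :
  0 <= e -> exists2 e' : R, 0 <= e' & e = e'%:C.
Proof.
by move=> e0; exists (complex.Re e); [rewrite -lecR|]; rewrite RRe_real ?ger0_real.
Qed.

Lemma unity_root_near1 (R : realType) (d : R) : 0 < d ->
  \forall N \near \oo, exists om : R[i], [/\ `|om| = 1, om ^+ N = 1,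
    (forall j, (0 < j < N)%N -> om ^+ j != 1) & `|om - 1| < d%:C].
Proof.
move=> d0.
pose a (N : nat) : R := 2 * pi * N.+1%:R^-1.
have a0 : a N @[N --> \oo] --> (0 : R).
  by rewrite -[X in _ --> X](mulr0 (2 * pi)); apply: cvgMr; exact: cvg_harmonic.
have ca : cos (a N) @[N --> \oo] --> (1 : R).
  by rewrite -cos0; apply: cvg_comp a0 _; exact: continuous_cos.
have sa : sin (a N) @[N --> \oo] --> (0 : R).
  by rewrite -sin0; apply: cvg_comp a0 _; exact: continuous_sin.
have d20 : 0 < d / 2 by rewrite divr_gt0.
suff : \forall N \near \oo, exists om : R[i], [/\ `|om| = 1, om ^+ N.+1 = 1,
    (forall j, (0 < j < N.+1)%N -> om ^+ j != 1) & `|om - 1| < d%:C].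
  case=> n _ nP; exists n.+1 => // -[//|N] /= nN; exact: nP.
near=> N.
have deM k : (cos (a N) +i* sin (a N)) ^+ k =
             cos (k%:R * a N) +i* sin (k%:R * a N).
  elim: k => [|k IH]; first by rewrite expr0 mul0r cos0 sin0.
  rewrite exprSr IH -natr1 mulrDl mul1r cosD sinD; apply/eqP.
  by rewrite eq_complex /= addrC eqxx /=; apply/eqP; ring.
exists (cos (a N) +i* sin (a N)); split.
- by rewrite normc_def/= cos2Dsin2 sqrtr1.
- rewrite deM /a mulrCA divff// mulr1 mulrC mulr_natr.
  by rewrite cos2pi sin2pi.
- move=> j /andP[j0 jN]; rewrite deM eq_complex/= negb_and; apply/orP; left.
  (* [b] is half the angle of [om ^+ j] and lies strictly between 0 and [pi], so
     [cos (b *+ 2) = 1 - 2 * sin b ^+ 2] differs from 1. *)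
  pose b : R := pi * (j%:R / N.+1%:R).
  have -> : j%:R * a N = b *+ 2 by rewrite /a /b -mulr_natl; ring.
  have sb : 0 < sin b.
    apply: sin_gt0_pi; rewrite mulr_gt0 ?pi_gt0 ?divr_gt0 ?ltr0n//=.
    by rewrite gtr_pMr ?pi_gt0// ltr_pdivrMr// mul1r ltr_nat.
  have : 0 < sin b ^+ 2 by rewrite exprn_gt0.
  by rewrite cos_mulr2n cos2sin2 => ?; apply/eqP => ?; lra.
- have -> : cos (a N) +i* sin (a N) - 1 =
            (cos (a N) - 1)%:C + 'i%C * (sin (a N))%:C.
    by apply/eqP; rewrite eq_complex/=; apply/andP; split; apply/eqP; ring.
  rewrite (le_lt_trans (ler_normD _ _))// normrM !normc_real.
  rewrite normc_i mul1r -rmorphD ltcR (splitr d) ltrD//.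
    by rewrite distrC; near: N; exact: cvgr_dist_lt.
  by rewrite -normrN -(sub0r (sin _)); near: N; exact: cvgr_dist_lt.
Unshelve. all: by end_near. Qed.

(** Each kernel is a geometric series of ratio [w / r * om^-1 ^+ k]. Cut after [N] terms, it leaves
    the factor [1 - (w / r) ^+ N], the same at every node. Summing over the nodes kills all powers
    but the zeroth, since [om] is primitive. *)
Lemma sum_cauchy_kernel (C : numFieldType) (r w om : C) (N : nat) :
  0 < r -> `|w| < r -> `|om| = 1 -> om ^+ N = 1 ->
  (forall j, (0 < j < N)%N -> om ^+ j != 1) ->
  (1 - (w / r) ^+ N) *
    \sum_(0 <= k < N) (r * om ^+ k / (r * om ^+ k - w)) = N%:R.
Proof.
move=> r0 wr om1 omN prim.
have om0 : om != 0 by rewrite -normr_gt0 om1.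
have uw k : r * om ^+ k - w != 0.
  apply/eqP => /subr0_eq uw; move: wr.
  by rewrite -uw normrM normrX om1 expr1n mulr1 gtr0_norm ?ltxx.
rewrite mulr_sumr (eq_big_nat _ _ (F2 := fun k =>
   \sum_(0 <= j < N) (w / r) ^+ j * (om^-1 ^+ j) ^+ k)); last first.
  move=> k _.
  have -> : \sum_(0 <= j < N) (w / r) ^+ j * (om^-1 ^+ j) ^+ k =
            \sum_(0 <= j < N) (w / r * om^-1 ^+ k) ^+ j.
    by apply: eq_bigr => j _; rewrite [in RHS]exprMn -!exprM mulnC.
  have : (w / r * om^-1 ^+ k) ^+ N - 1 =
    (w / r * om^-1 ^+ k - 1) *
      \sum_(0 <= j < N) (w / r * om^-1 ^+ k) ^+ j.
    by rewrite big_mkord subrX1.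
  rewrite [(w / r * _) ^+ N]exprMn exprAC [om^-1 ^+ N]exprVn omN invr1 expr1n mulr1.
  set s := \sum_(_ <= _ < _) _ => h.
  rewrite -opprB h exprVn; field.
  by rewrite uw expf_neq0//= gt_eqF.
rewrite exchange_big_nat/=; case: N prim omN => [|N] prim omN.
  by rewrite big_geq.
rewrite big_nat_recl//= [X in X + _](eq_bigr (fun=> 1)); last first.
  by move=> i _; rewrite !expr0 expr1n mulr1.
rewrite sumr_const_nat subn0 [X in _ + X]big_nat big1 ?addr0// => j /= jN.
rewrite -mulr_sumr; have /eqP : (om^-1 ^+ j.+1 - 1) *
    \sum_(0 <= k < N.+1) (om^-1 ^+ j.+1) ^+ k = 0.
  by rewrite big_mkord -subrX1 exprAC exprVn omN invr1 expr1n subrr.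
rewrite mulf_eq0 subr_eq0 exprVn invr_eq1.
by rewrite (negbTE (prim _ _)) ?ltnS//= => /eqP ->; rewrite mulr0.
Qed.

Definition uniformly_differentiable_on_disc (C : numFieldType) (r : C)
    (g D : C -> C) : Prop :=
  forall e, 0 < e -> exists2 d, 0 < d & forall a b,
    `|a| <= r -> `|b| <= r -> `|a - b| < d ->
    `|g a - g b - D b * (a - b)| <= e * `|a - b|.

(** For [om] a primitive [N]-th root of unity, this is the Riemann sum of Cauchy's integral of [g]
    over the circle of radius [r], evaluated at [w]. *)
Definition cauchy_mean (C : numFieldType) (g : C -> C) (r om : C) (N : nat)
    (w : C) : C :=
  N%:R^-1 * \sum_(0 <= k < N) g (r * om ^+ k) * (r * om ^+ k / (r * om ^+ k - w)).

(** The same [N] and [om] serve every [w], so that values of [g] at several points can be compared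
    through the same nodes. *)
Lemma cauchy_mean_approx (R : realType) (r M : R[i]) (g D : R[i] -> R[i]) :
  0 < r -> uniformly_differentiable_on_disc r g D ->
  (forall a, `|a| <= r -> `|g a| <= M) ->
  forall eta, 0 < eta -> exists N om, [/\ (0 < N)%N, `|om| = 1 &
    forall w, `|w| <= r / 2 -> `|g w - cauchy_mean g r om N w| <= eta].
Proof.
move=> r0 gD gM eta eta0.
have M0 : 0 <= M.
  by rewrite (le_trans (normr_ge0 (g 0)))// gM// normr0 ltW.
(* With this precision the sum [S] below is at most [N * eta / 4]; the factor [1 - s ^+ N], at most
   2 in norm, turns this into [eta / 2] after division by [N]. *)
have [|d d0 {}gD] := gD (eta / (8 * r)); first by rewrite divr_gt0 ?mulr_gt0.
have [r' r'0 rE] := gt0_complexP r0.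
have [M' M'0 ME] := ge0_complexP M0.
have [eta' eta'0 etaE] := gt0_complexP eta0.
have [d' d'0 dE] := gt0_complexP d0.
(* This bounds the truncation term: [g] is at most [M], the kernel at most 2, and [w / r] at most
   [2^-1] in norm. *)
have small : \forall N \near \oo, M' * 2 * 2^-1 ^+ N < eta' / 2.
  have : geometric (M' * 2) (2^-1 : R) N @[N --> \oo] --> 0.
    by apply: cvg_geometric; rewrite gtr0_norm ?invr_gt0// invf_lt1// ltr1n.
  by move/cvgr_lt; apply; rewrite divr_gt0.
have [m md] : exists m, 2 * r / m.+1%:R < d.
  near \oo => m; exists m.
  have -> : 2 * r / m.+1%:R = (2 * r' * m.+1%:R^-1)%:C.
    by rewrite rE !rmorphM fmorphV !rmorph_nat.
  rewrite dE ltcR -ltr_pdivlMl ?mulr_gt0//; near: m.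
  have cd : 0 < (2 * r')^-1 * d' by rewrite mulr_gt0 ?invr_gt0 ?mulr_gt0.
  exact: (near_infty_natSinv_lt (PosNum cd)).
near \oo => N.
have : exists om : R[i], [/\ `|om| = 1, om ^+ N = 1,
    (forall j, (0 < j < N)%N -> om ^+ j != 1) & `|om - 1| < (d' / r')%:C].
  by near: N; apply: unity_root_near1; rewrite divr_gt0.
case=> om [om1 omN prim omd].
have N1 : (1 < N)%N by near: N; exists 2%N.
have N0 : (0 : R[i]) < N%:R by rewrite ltr0n ltnW.
exists N, om; split=> //; first exact: ltnW.
move=> w wr.
have wltr : `|w| < r by rewrite (le_lt_trans wr)// ltr_pdivrMr// ltr_pMr// ltr1n.
have romd : r * `|om - 1| < d.
  have drE : (d' / r')%:C = d / r by rewrite rmorphM fmorphV dE rE.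
  by move: omd; rewrite drE ltr_pdivlMr// mulrC.
have om_n1 : om != 1 by rewrite -(expr1 om) prim.
have := discrete_cauchy_estimate r0 wltr om1 omN om_n1 (ltn0Sn m) gD romd md.
have := sum_cauchy_kernel r0 wltr om1 omN prim.
have knorm k : `|r * om ^+ k / (r * om ^+ k - w)| <= 2.
  have nu : `|r * om ^+ k| = r by rewrite normrM normrX om1 expr1n mulr1 gtr0_norm.
  rewrite normrM normfV nu.
  have uw : r / 2 <= `|r * om ^+ k - w|.
    rewrite (le_trans _ (lerB_dist _ _))// nu lerBrDl -lerBrDr.
    by rewrite (le_trans wr)// {2}(splitr r) addrK.
  rewrite ler_pdivrMr; last by rewrite (lt_le_trans _ uw)// divr_gt0.
  by rewrite mulrC -ler_pdivrMr.
rewrite /cauchy_mean.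
set K := \sum_(_ <= _ < _) _; set S := \sum_(_ <= _ < _) _.
set A := \sum_(_ <= _ < _) _ => KE Sle.
have SE : S = A - g w * K.
  by rewrite /S /A /K mulr_sumr -sumrB; apply: eq_bigr => k _; rewrite mulrBl.
set s := w / r in KE.
have s2 : `|s| <= 2^-1 by rewrite normrM normfV (gtr0_norm r0) ler_pdivrMr// mulrC.
have sN : `|s ^+ N| <= 2^-1 ^+ N by rewrite normrX lerXn2r// nnegrE.
have sN1 : `|s ^+ N| <= 1.
  by rewrite (le_trans sN)// exprn_ile1// invf_le1// ler1n.
(* The error splits into the discrete Cauchy sum [S] and the truncation term carrying [s ^+ N]. *)
have -> : g w - N%:R^-1 * A =
   - (N%:R^-1 * ((1 - s ^+ N) * S)) - s ^+ N * (N%:R^-1 * A).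
  have -> : (1 - s ^+ N) * S = (1 - s ^+ N) * A - N%:R * g w.
    by rewrite SE -KE; ring.
  by field; rewrite gt_eqF.
rewrite (le_trans (ler_normB _ _))// normrN (splitr eta) lerD//.
  rewrite !normrM normfV (gtr0_norm N0) ler_pdivrMl//.
  have -> : N%:R * (eta / 2) = 2 * (2 * N%:R * (eta / (8 * r)) * r).
    by field; rewrite gt_eqF.
  rewrite ler_pM// (le_trans (ler_normB _ _))// normr1.
  by rewrite (_ : 2 = 1 + 1)// lerD. 
have Ale : `|A| <= N%:R * (M * 2).
  rewrite (le_trans (ler_norm_sum _ _ _))//.
  have -> : N%:R * (M * 2) = \sum_(0 <= k < N) (M * 2).
    by rewrite sumr_const_nat subn0 mulr_natl.
  apply: ler_sum => k _; rewrite normrM ler_pM// gM//.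
  by rewrite normrM normrX om1 expr1n mulr1 gtr0_norm.
rewrite normrM (@le_trans _ _ (2^-1 ^+ N * (M * 2)))//.
  rewrite ler_pM// normrM normfV (gtr0_norm N0) ler_pdivrMl//.
have : M' * 2 * 2^-1 ^+ N < eta' / 2 by near: N.
rewrite mulrC -ltcR => /ltW.
have -> : (2^-1 ^+ N * (M' * 2))%:C = 2^-1 ^+ N * (M * 2).
  by rewrite ME !rmorphM rmorphXn fmorphV !rmorph_nat.
have -> : (eta' / 2)%:C = eta / 2 by rewrite etaE rmorphM fmorphV rmorph_nat.
by [].
Unshelve. all: by end_near. Qed.

(** * Cauchy estimates of first and second order on a disc *)

Section cauchy_estimates.
Context {R : realType} (r M : R[i]) (g D : R[i] -> R[i]).
Hypotheses (r0 : 0 < r) (gD : uniformly_differentiable_on_disc r g D).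
Hypothesis gM : forall a, `|a| <= r -> `|g a| <= M.

Let M0 : 0 <= M.
Proof. by rewrite (le_trans (normr_ge0 (g 0)))// gM// normr0 ltW. Qed.

Let unorm (om : R[i]) k : `|om| = 1 -> `|r * om ^+ k| = r.
Proof. by move=> om1; rewrite normrM normrX om1 expr1n mulr1 gtr0_norm. Qed.

Let distu (om w : R[i]) k : `|om| = 1 -> `|w| <= r / 2 ->
  r / 2 <= `|r * om ^+ k - w|.
Proof.
move=> om1 wr; rewrite (le_trans _ (lerB_dist _ _))// unorm// lerBrDl -lerBrDr.
by rewrite (le_trans wr)// {2}(splitr r) addrK.
Qed.

Let r20 : 0 < r / 2. Proof. by rewrite divr_gt0. Qed.

Let distu0 (om w : R[i]) k : `|om| = 1 -> `|w| <= r / 2 ->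
  0 < `|r * om ^+ k - w|.
Proof. by move=> om1 wr; rewrite (lt_le_trans r20)// distu. Qed.

(** The kernels at [a] and at 0 differ by [a / (r * om ^+ k - a)], of norm at most [|a| / (r / 2)];
    the approximation error is arbitrary. *)
Lemma cauchy_lipschitz a : `|a| <= r / 2 ->
  `|g a - g 0| <= 2 * M / r * `|a|.
Proof.
move=> ar; apply/ler_addgt0Pr => e e0.
have [|N [om [N0 om1 ap]]] := cauchy_mean_approx r0 gD gM (eta := e / 2).
  by rewrite divr_gt0.
have NC : (0 : R[i]) < N%:R by rewrite ltr0n.
set E := cauchy_mean g r om N in ap.
have -> : g a - g 0 = (E a - E 0) + ((g a - E a) - (g 0 - E 0)) by ring.
rewrite (le_trans (ler_normD _ _))// lerD//; last first.
  rewrite (le_trans (ler_normB _ _))// (splitr e) lerD ?ap// normr0 ltW//.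
rewrite /E /cauchy_mean -mulrBr -sumrB normrM normfV (gtr0_norm NC).
rewrite ler_pdivrMl// (le_trans (ler_norm_sum _ _ _))//.
have -> : N%:R * (2 * M / r * `|a|) = \sum_(0 <= k < N) (2 * M / r * `|a|).
  by rewrite sumr_const_nat subn0 mulr_natl.
apply: ler_sum => k _.
have ua : r * om ^+ k - a != 0 by rewrite -normr_gt0 distu0.
have on0 : om ^+ k != 0 by rewrite -normr_gt0 normrX om1 expr1n.
rewrite -mulrBr.
have -> : r * om ^+ k / (r * om ^+ k - a) - r * om ^+ k / (r * om ^+ k - 0) =
          a / (r * om ^+ k - a).
  by rewrite subr0; field; rewrite ua on0 gt_eqF.
have -> : 2 * M / r * `|a| = M * (`|a| / (r / 2)) by field; rewrite gt_eqF.
rewrite normrM normrM normfV ler_pM ?divr_ge0// ?gM ?unorm//.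
by rewrite ler_wpM2l// lef_pV2 ?posrE ?distu// distu0.
Qed.

(* The divided difference [g[0, a, b]] multiplied by [a * b * (a - b)]. *)
Lemma cauchy_divided_difference a b : `|a| <= r / 2 -> `|b| <= r / 2 ->
  `|b * (g a - g 0) - a * (g b - g 0)|
    <= 4 * M / r ^+ 2 * (`|a| * `|b| * `|a - b|).
Proof.
move=> ar br; apply/ler_addgt0Pr => e e0.
(* The approximation error enters four times, each time with a factor [a] or [b] of norm at most
   [r / 2], which gives [e] in all. *)
have [|N [om [N0 om1 ap]]] := cauchy_mean_approx r0 gD gM (eta := e / (2 * r)).
  by rewrite divr_gt0// mulr_gt0.
have NC : (0 : R[i]) < N%:R by rewrite ltr0n.
set E := cauchy_mean g r om N in ap.
have -> : b * (g a - g 0) - a * (g b - g 0) =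
  (b * (E a - E 0) - a * (E b - E 0)) +
  (b * ((g a - E a) - (g 0 - E 0)) - a * ((g b - E b) - (g 0 - E 0))) by ring.
have z2 : `|0 : R[i]| <= r / 2 by rewrite normr0 ltW.
rewrite (le_trans (ler_normD _ _))// lerD//; last first.
  have -> : e = r / 2 * (e / (2 * r) + e / (2 * r)) +
                r / 2 * (e / (2 * r) + e / (2 * r)).
    by field; rewrite gt_eqF.
  rewrite (le_trans (ler_normB _ _))// !normrM lerD// ler_pM//.
    by rewrite (le_trans (ler_normB _ _))// lerD ?ap.
  by rewrite (le_trans (ler_normB _ _))// lerD ?ap.
have -> : b * (E a - E 0) - a * (E b - E 0) =
  N%:R^-1 * \sum_(0 <= k < N) g (r * om ^+ k) *
     (a * b * (a - b) / ((r * om ^+ k - a) * (r * om ^+ k - b))).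
  rewrite /E /cauchy_mean -!mulrBr -!sumrB ![b * _]mulrCA ![a * _]mulrCA.
  rewrite -mulrBr; congr (_ * _).
  rewrite !mulr_sumr -sumrB; apply: eq_bigr => k _.
  have ua : r * om ^+ k - a != 0 by rewrite -normr_gt0 distu0.
  have ub : r * om ^+ k - b != 0 by rewrite -normr_gt0 distu0.
  have on0 : om ^+ k != 0 by rewrite -normr_gt0 normrX om1 expr1n.
  by rewrite subr0; field; rewrite ua ub on0 gt_eqF.
rewrite normrM normfV (gtr0_norm NC).
rewrite ler_pdivrMl// (le_trans (ler_norm_sum _ _ _))//.
set c := 4 * M / _ * _.
have -> : N%:R * c = \sum_(0 <= k < N) c.
  by rewrite sumr_const_nat subn0 mulr_natl.
apply: ler_sum => k _.
have -> : c = M * (`|a| * `|b| * `|a - b| / (r / 2 * (r / 2))).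
  by rewrite /c; field; rewrite gt_eqF.
rewrite normrM normrM normfV !normrM ler_pM ?divr_ge0 ?mulr_ge0// ?gM ?unorm//.
rewrite ler_wpM2l ?mulr_ge0// lef_pV2 ?posrE ?mulr_gt0 ?distu0//.
by rewrite ler_pM ?distu// ltW.
Qed.

(** Divide the divided difference estimate by [b] and let [b] tend to 0 along the positive reals:
    [(g b - g 0) / b] tends to [D 0]. *)
Lemma cauchy_taylor2 a : `|a| <= r / 2 ->
  `|g a - g 0 - a * D 0| <= 4 * M / r ^+ 2 * `|a| ^+ 2.
Proof.
move=> ar; have [->|a0] := eqVneq a 0.
  by rewrite !(subrr, mul0r) normr0 expr0n mulr0.
have na0 : 0 < `|a| by rewrite normr_gt0.
apply/ler_addgt0Pr => e e0.
set c := 4 * M / r ^+ 2.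
have c0 : 0 <= c by rewrite divr_ge0 ?mulr_ge0 ?exprn_ge0// ltW.
have [|d d0 {}gD'] := gD (e := e / (2 * `|a|)); first by rewrite divr_gt0// mulr_gt0.
pose k := e / 2 / (c + 1) / `|a|.
have k0 : 0 < k by rewrite !divr_gt0// ltr_wpDl.
have [d' d'0 dE] := gt0_complexP d0.
have [r' r'0 rE] := gt0_complexP r20.
have [k' k'0 kE] := gt0_complexP k0.
(* The three bounds serve in turn the differentiability at 0, the divided difference estimate, and
   [c * |a| * b <= e / 2]. *)
pose b : R[i] := (Num.min (d' / 2) (Num.min r' k'))%:C.
have b0 : 0 < b by rewrite ltcR !lt_min r'0 k'0 divr_gt0.
have bd : b < d.
  rewrite dE ltcR gt_min; apply/orP; left.
  by rewrite ltr_pdivrMr// ltr_pMr// ltr1n.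
have br : b <= r / 2 by rewrite rE lecR !ge_min lexx orbT.
have bk : b <= k by rewrite kE lecR !ge_min lexx !orbT.
have br' : `|b| <= r / 2 by rewrite gtr0_norm.
have h1 := cauchy_divided_difference ar br'.
have h2 : `|g b - g 0 - D 0 * b| <= e / (2 * `|a|) * b.
  have := gD' b 0; rewrite subr0 normr0 (gtr0_norm b0); apply => //.
    by rewrite (le_trans br)// ler_pdivrMr// ler_pMr// ler1n.
  exact: ltW.
rewrite -(ler_pM2l b0).
have -> : b * `|g a - g 0 - a * D 0| =
   `|(b * (g a - g 0) - a * (g b - g 0)) + a * (g b - g 0 - D 0 * b)|.
  by rewrite -{1}(gtr0_norm b0) -normrM; congr `|_|; ring.
rewrite (le_trans (ler_normD _ _))//.
have -> : b * (c * `|a| ^+ 2 + e) =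
    (c * `|a| ^+ 2 * b + b * (e / 2)) + b * (e / 2) by field.
rewrite lerD//; last first.
  rewrite normrM; have -> : b * (e / 2) = `|a| * (e / (2 * `|a|) * b).
    by field; rewrite gt_eqF.
  by rewrite ler_pM2l.
apply: le_trans h1 _; rewrite (gtr0_norm b0) -/c.
have -> : c * (`|a| * b * `|a - b|) = c * `|a| * b * `|a - b| by ring.
rewrite (@le_trans _ _ (c * `|a| * b * (`|a| + b)))//.
  have ca0 : 0 <= c * `|a| := mulr_ge0 c0 (normr_ge0 a).
  have cb0 : 0 <= c * `|a| * b := mulr_ge0 ca0 (ltW b0).
  by rewrite ler_wpM2l// (le_trans (ler_normB _ _))// (gtr0_norm b0).
have -> : c * `|a| * b * (`|a| + b) = c * `|a| ^+ 2 * b + b * (c * `|a| * b).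
  by ring.
rewrite lerD// ler_pM2l//.
rewrite (@le_trans _ _ ((c + 1) * `|a| * k))//.
  apply: ler_pM => //; [exact: mulr_ge0|exact: ltW|].
  by rewrite ler_wpM2r// lerDl.
rewrite /k le_eqVlt; apply/orP; left; apply/eqP; field.
by rewrite !gt_eqF ?ltr_wpDl.
Qed.

End cauchy_estimates.

(** * Slices of holomorphic maps *)

Lemma normc_ge_Im (R : rcfType) (x : R[i]) : `|complex.Im x|%:C <= `|x|.
Proof.
have := normc_ge_Re (x * 'i%C); rewrite ReiNIm normrN normrM.
by rewrite normc_i mulr1.
Qed.

Lemma normc_le_ReIm (R : rcfType) (x : R[i]) :
  `|x| <= (`|complex.Re x| + `|complex.Im x|)%:C.
Proof.
rewrite {1}(complexE x) (le_trans (ler_normD _ _))// normrM !normc_real.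
by rewrite normc_i mul1r -rmorphD lexx.
Qed.

Lemma Re_realM (R : rcfType) (a : R) (x : R[i]) :
  complex.Re (a%:C * x) = a * complex.Re x.
Proof. by case: x => b c /=; rewrite mul0r subr0. Qed.

Lemma Im_realM (R : rcfType) (a : R) (x : R[i]) :
  complex.Im (a%:C * x) = a * complex.Im x.
Proof. by case: x => b c /=; rewrite mul0r addr0. Qed.

Section complex_limits.
Context {R : realType} {T : Type} {F : set_system T} {FF : Filter F}.

Lemma cvg_Re (f : T -> R[i]^o) (l : R[i]^o) :
  f @ F --> l -> (fun t => complex.Re (f t)) @ F --> complex.Re l.
Proof.
move=> fl; apply/cvgrPdist_lt => e e0.
move/cvgrPdist_lt : fl => /(_ e%:C); rewrite ltcR => /(_ e0).
apply: filterS => t; rewrite -ltcR; apply: le_lt_trans.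
by rewrite -raddfB; exact: normc_ge_Re.
Qed.

Lemma cvg_Im (f : T -> R[i]^o) (l : R[i]^o) :
  f @ F --> l -> (fun t => complex.Im (f t)) @ F --> complex.Im l.
Proof.
move=> fl; apply/cvgrPdist_lt => e e0.
move/cvgrPdist_lt : fl => /(_ e%:C); rewrite ltcR => /(_ e0).
apply: filterS => t; rewrite -ltcR; apply: le_lt_trans.
by rewrite -raddfB; exact: normc_ge_Im.
Qed.

Lemma cvg_complex (f : T -> R[i]^o) (a b : R) :
  (fun t => complex.Re (f t)) @ F --> a ->
  (fun t => complex.Im (f t)) @ F --> b -> f @ F --> (a +i* b : R[i]^o).
Proof.
move=> fa fb; apply/cvgrPdist_lt => _/gt0_complexP[e e0 ->].
have e2 : 0 < e / 2 by rewrite divr_gt0.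
move/cvgrPdist_lt : fa => /(_ _ e2) fa; move/cvgrPdist_lt : fb => /(_ _ e2) fb.
apply: filterS2 fa fb => t ta tb; rewrite (le_lt_trans (normc_le_ReIm _))//.
by rewrite !raddfB/= ltcR (splitr e) ltrD.
Qed.

End complex_limits.

(** The increment may have either sign, since it will be the real or the imaginary part of a
    difference; assumptions on the symmetric interval cover both cases. *)
Lemma mvt_signed (R : realType) (f df : R -> R) (h : R) : h != 0 ->
  (forall t : R, `|t| <= `|h| -> is_derive (t : R) (1 : R) f (df t)) ->
  exists2 c, `|c| <= `|h| & f h - f 0 = df c * h.
Proof.
move=> h0 fd.
have cf a b : `|a| <= `|h| -> `|b| <= `|h| -> {within `[a, b], continuous f}.
  move=> ah bh; apply: derivable_within_continuous => x.
  rewrite in_itv/= => /andP[ax xb].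
  have xh : `|x| <= `|h|.
    move: ah bh; rewrite !ler_norml => /andP[a1 a2] /andP[b1 b2].
    by rewrite (le_trans a1)//= (le_trans xb).
  by have [] := fd _ xh.
have [hgt|] := ltP 0 h.
  have [] := @MVT _ f df 0 h hgt.
  - move=> x; rewrite in_itv/= => /andP[x0 xh]; apply: fd.
    by rewrite !gtr0_norm// ltW.
  - by apply: cf; rewrite ?normr0.
  move=> c; rewrite in_itv/= => /andP[c0 ch] ->; rewrite subr0.
  by exists c => //; rewrite !gtr0_norm// ltW.
rewrite le_eqVlt (negbTE h0)/= => hlt.
have [] := @MVT _ f df h 0 hlt.
- move=> x; rewrite in_itv/= => /andP[x0 xh]; apply: fd.
  by rewrite !ltr0_norm// lerN2 ltW.
- by apply: cf; rewrite ?normr0.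
move=> c; rewrite in_itv/= => /andP[c0 ch] E.
exists c; first by rewrite !ltr0_norm// lerN2 ltW.
by rewrite -opprB E sub0r mulrN opprK.
Qed.

(** The mean value theorem applies to the real and imaginary parts separately, at different
    intermediate points, whence the factor 2. *)
Lemma complex_mean_value_ineq (R : realType) (f df : R -> R[i]) (c : R[i])
    (e h : R) :
  (forall t, `|t| <= `|h| ->
     ((s%:C)^-1 * (f (t + s) - f t) : R[i]^o) @[s --> (0 : R)^'] --> (df t : R[i]^o)) ->
  (forall t, `|t| <= `|h| -> `|df t - c| <= e%:C) ->
  `|f h - f 0 - h%:C * c| <= (2 * e * `|h|)%:C.
Proof.
move=> fd dfc; have [->|h0] := eqVneq h 0.
  by rewrite subrr mul0r !normr0 mulr0 subrr normr0.
have dRe (t : R) : `|t| <= `|h| ->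
    is_derive (t : R) (1 : R) (fun s => complex.Re (f s)) (complex.Re (df t)).
  move=> /fd/cvg_Re ft.
  have {}ft : s^-1 *: (complex.Re (f (s *: 1 + t)) - complex.Re (f t))
      @[s --> (0 : R)^'] --> complex.Re (df t).
    apply: cvg_trans ft; apply: near_eq_cvg; near=> s.
    rewrite -[s *: 1]/(s * 1) mulr1 (addrC s) -raddfB -fmorphV.
    by rewrite [LHS]Re_realM.
  by apply: DeriveDef; [apply/cvg_ex; eexists; exact: ft|exact: cvg_lim ft].
have dIm (t : R) : `|t| <= `|h| ->
    is_derive (t : R) (1 : R) (fun s => complex.Im (f s)) (complex.Im (df t)).
  move=> /fd/cvg_Im ft.
  have {}ft : s^-1 *: (complex.Im (f (s *: 1 + t)) - complex.Im (f t))
      @[s --> (0 : R)^'] --> complex.Im (df t).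
    apply: cvg_trans ft; apply: near_eq_cvg; near=> s.
    rewrite -[s *: 1]/(s * 1) mulr1 (addrC s) -raddfB -fmorphV.
    by rewrite [LHS]Im_realM.
  by apply: DeriveDef; [apply/cvg_ex; eexists; exact: ft|exact: cvg_lim ft].
have [x xh Ex] := mvt_signed h0 dRe.
have [y yh Ey] := mvt_signed h0 dIm.
rewrite (le_trans (normc_le_ReIm _))// lecR.
have -> : complex.Re (f h - f 0 - h%:C * c) = complex.Re (df x - c) * h.
  rewrite 3!raddfB/= Ex; case: (c) => a b /=; ring.
have -> : complex.Im (f h - f 0 - h%:C * c) = complex.Im (df y - c) * h.
  rewrite 3!raddfB/= Ey; case: (c) => a b /=; ring.
have -> : 2 * e * `|h| = e * `|h| + e * `|h| by ring.
rewrite !normrM lerD// ler_wpM2r//.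
  by rewrite -lecR (le_trans (normc_ge_Re _))// dfc.
by rewrite -lecR (le_trans (normc_ge_Im _))// dfc.
Unshelve. all: by end_near. Qed.

Section dual_evaluation.
Context {R : realType} {Z : normedModType R[i]}.
Implicit Types (y : dual Z) (z : Z).

Lemma dual_subE y1 y2 z : (y1 - y2) z = y1 z - y2 z.
Proof. by []. Qed.

Lemma dual_scaleE (a : R[i]) y z : (a *: y) z = a * y z.
Proof. by []. Qed.

Lemma dual_eval_le y z : `|y z| <= `|y| * `|z|.
Proof. exact: le_opnorm. Qed.

Lemma dual_normE y : `|y| = (opnorm y)%:C.
Proof. by []. Qed.

Lemma dual_norm_le y (M : R) :
  (forall z, `|y z| <= M%:C * `|z|) -> 0 <= M -> `|y| <= M%:C.
Proof.
move=> yM M0; rewrite dual_normE lecR; apply: opnorm_le => z z1.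
by rewrite (le_trans (yM z))// ler_piMr// lecR.
Qed.

Lemma cvg_dual_eval (T : Type) (F : set_system T) {FF : Filter F}
    (f : T -> dual Z) y z :
  f @ F --> y -> (fun t => f t z : R[i]^o) @ F --> (y z : R[i]^o).
Proof.
move=> fy; apply/cvgrPdist_lt => e e0.
(* Adding 1 avoids a division by zero when [z = 0]; the same device recurs below with other
   constants. *)
have z1 : 0 < `|z| + 1 by rewrite ltr_wpDl.
move/cvgrPdist_lt : fy => /(_ (e / (`|z| + 1))); rewrite divr_gt0// => /(_ isT).
apply: filterS => t; rewrite ltr_pdivlMr// => fe.
rewrite -dual_subE (le_lt_trans (dual_eval_le _ _))// (le_lt_trans _ fe)//.
by rewrite ler_wpM2l// lerDl.
Qed.

End dual_evaluation.

Lemma open_setXT (T U : topologicalType) (A : set T) :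
  open A -> open (A `*` [set: U]).
Proof.
rewrite !openE => oA [x y] [/= /oA Ax _].
by exists (A, setT); [split=> //=; exact: filterT|].
Qed.

Section slices.
Context {R : realType} {X Z : normedModType R[i]}.
Variables (Omega : set X) (u : X -> dual Z).
Hypotheses (oO : open Omega) (uh : holomorphic Omega u).

Lemma cvg_du q v : Omega q -> diff_quotient u q v e @[e --> (0 : R)^'] --> du u q v.
Proof. by case: uh => -[+ _] _ => /[apply]. Qed.

Lemma continuous_du q v : Omega q ->
  {for (q, v), continuous (fun qv : X * X => du u qv.1 qv.2)}.
Proof.
move=> Oq; case: uh => -[_ +] _.
rewrite continuous_open_subspace; last exact: open_setXT.
by apply; rewrite inE.
Qed.

Lemma du_i q v : Omega q -> du u q ('i%C *: v) = 'i%C *: du u q v.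
Proof.
move=> Oq; case: uh => _ /(_ q v Oq); rewrite /Dbar => /eqP.
rewrite scaler_eq0 invr_eq0 pnatr_eq0/= => /eqP E.
have -> : du u q v = - ('i%C *: du u q ('i%C *: v)).
  by apply/eqP; rewrite -addr_eq0 E.
by rewrite scalerN scalerA -expr2 sqr_i scaleN1r opprK.
Qed.

Variables (x v : X) (z : Z).
Let g (s : R[i]) : R[i] := u (x + s *: v) z.
Let D (s : R[i]) : R[i] := du u (x + s *: v) v z.

Let g_line (b c : R[i]) (t : R) : Omega (x + (b + t%:C * c) *: v) ->
  ((s%:C)^-1 * (g (b + (t + s)%:C * c) - g (b + t%:C * c)) : R[i]^o)
    @[s --> (0 : R)^'] --> (du u (x + (b + t%:C * c) *: v) (c *: v) z : R[i]^o).
Proof.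
move=> Oq; have /(cvg_dual_eval (z := z)) h := cvg_du (v := c *: v) Oq.
apply: cvg_trans h.
apply: near_eq_cvg; near=> s.
rewrite /diff_quotient dual_scaleE dual_subE /g.
congr (_ * (u _ z - _)).
by rewrite [(t + s)%:C]rmorphD mulrDl addrA scalerA [in RHS]scalerDl addrA.
Unshelve. all: by end_near. Qed.

Lemma slice_near (s0 : R[i]) (e : R) : 0 < e -> Omega (x + s0 *: v) ->
  exists2 d : R, 0 < d & forall s, `|s - s0| < d%:C ->
    Omega (x + s *: v) /\ `|D s - D s0| <= e%:C.
Proof.
move=> e0 Oq.
have FF : Filter (nbhs (s0 : R[i]^o)) by exact: nbhs_filter.
have cl : (fun s : R[i]^o => x + s *: v) @ (s0 : R[i]^o) --> x + s0 *: v.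
  apply/cvgrPdist_lt => eta eta0.
  have v1 : 0 < `|v| + 1 by rewrite ltr_wpDl.
  have ev : 0 < eta / (`|v| + 1) by rewrite divr_gt0.
  have /cvgrPdist_lt/(_ _ ev) : (fun s : R[i]^o => s) @ (s0 : R[i]^o) --> (s0 : R[i]^o).
    exact: cvg_id.
  apply: filterS => s; rewrite ltr_pdivlMr// => ss.
  rewrite opprD addrACA subrr add0r -scalerBl normrZ (le_lt_trans _ ss)//.
  by rewrite ler_wpM2l// lerDl.
have : \forall s \near (s0 : R[i]^o), Omega (x + s *: v) /\ `|D s - D s0| <= e%:C.
  have O1 : \forall s \near (s0 : R[i]^o), Omega (x + s *: v).
    by apply: cl; apply: open_nbhs_nbhs.
  have c2 : (fun s : R[i]^o => D s : R[i]^o) @ (s0 : R[i]^o) --> (D s0 : R[i]^o).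
    apply: cvg_dual_eval.
    apply: (@cvg_comp _ _ _ (fun s : R[i]^o => (x + s *: v, v))
      (fun qv => du u qv.1 qv.2) _ (nbhs (x + s0 *: v, v))).
      by apply: cvg_pair => //=; exact: cvg_cst.
    exact: continuous_du.
  have O2 : \forall s \near (s0 : R[i]^o), `|D s - D s0| <= e%:C.
    move/cvgrPdist_le : c2 => /(_ e%:C); rewrite ltcR => /(_ e0).
    by apply: filterS => s; rewrite distrC.
  by near=> s; split; near: s.
case/nbhs_ballP => _ /= /gt0_complexP[d d0 ->] dP; exists d => // s sd.
by apply: dP; rewrite /ball/= distrC.
Unshelve. all: by end_near. Qed.

(** Go from [b] to [a] by a real and then an imaginary displacement. On each leg the derivative
    stays close to [D s0] or ['i%C * D s0], by continuity and [du_i], so the two increments add up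
    to nearly [D s0 * (a - b)]. Both points vary, which the compactness argument below requires. *)
Lemma slice_strictly_differentiable (s0 : R[i]) (e : R) :
  0 < e -> Omega (x + s0 *: v) ->
  exists2 d : R, 0 < d & forall a b, `|a - s0| < d%:C -> `|b - s0| < d%:C ->
    `|g a - g b - D b * (a - b)| <= e%:C * `|a - b|.
Proof.
move=> e0 Oq; have e50 : 0 < e / 5 by rewrite divr_gt0.
have [d d0 dP] := slice_near e50 Oq.
(* Starting within [d / 5] of [s0], the two legs have length at most [2 * d / 5] each, so the path
   stays within [d]. *)
exists (d / 5) => [|a b ad bd]; first by rewrite divr_gt0.
pose al := complex.Re (a - b); pose be := complex.Im (a - b).
have abE : a - b = al%:C + 'i%C * be%:C by exact: complexE.
have ab : `|a - b| <= (d / 5 + d / 5)%:C.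
  have -> : a - b = (a - s0) - (b - s0) by ring.
  by rewrite (le_trans (ler_normB _ _))// rmorphD lerD// ltW.
have ale : `|al|%:C <= `|a - b| by exact: normc_ge_Re.
have bee : `|be|%:C <= `|a - b| by exact: normc_ge_Im.
have near1 (t : R) : `|t| <= `|al| -> `|b + t%:C * 1 - s0| < d%:C.
  move=> tal; have -> : b + t%:C * 1 - s0 = (b - s0) + t%:C by ring.
  rewrite (le_lt_trans (ler_normD _ _))// normc_real.
  have -> : d%:C = (d / 5)%:C + (d * 4 / 5)%:C by rewrite -rmorphD; congr _%:C; field.
  rewrite ltr_leD//; apply: (@le_trans _ _ `|al|%:C); first by rewrite lecR.
  by rewrite (le_trans ale)// (le_trans ab)// lecR; lra.
have near2 (t : R) : `|t| <= `|be| -> `|b + al%:C + t%:C * 'i%C - s0| < d%:C.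
  move=> tbe; have -> : b + al%:C + t%:C * 'i%C - s0 = (b - s0) + (al%:C + 'i%C * t%:C) by ring.
  rewrite (le_lt_trans (ler_normD _ _))//.
  have -> : d%:C = (d / 5)%:C + ((d / 5 + d / 5) + (d / 5 + d / 5))%:C.
    by rewrite -rmorphD; congr _%:C; field.
  rewrite ltr_leD// (le_trans (normc_le_ReIm _))//.
  have -> : complex.Re (al%:C + 'i%C * t%:C) = al by rewrite /=; ring.
  have -> : complex.Im (al%:C + 'i%C * t%:C) = t by rewrite /=; ring.
  rewrite rmorphD [X in _ <= X]rmorphD lerD//; first by rewrite (le_trans ale).
  by apply: le_trans (le_trans bee ab); rewrite lecR.
have h1 : `|g (b + al%:C) - g b - al%:C * D s0| <= (2 * (e / 5) * `|al|)%:C.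
  have := @complex_mean_value_ineq _ (fun t => g (b + t%:C * 1))
     (fun t => D (b + t%:C * 1)) (D s0) (e / 5) al.
  rewrite mulr1 mul0r addr0; apply.
  - move=> t tal; have [Ot _] := dP _ (near1 _ tal).
    by have := g_line Ot; rewrite scale1r.
  - by move=> t tal; have [_] := dP _ (near1 _ tal).
have h2 : `|g (b + al%:C + be%:C * 'i%C) - g (b + al%:C) - be%:C * ('i%C * D s0)| <= (2 * (e / 5) * `|be|)%:C.
  have := @complex_mean_value_ineq _ (fun t => g (b + al%:C + t%:C * 'i%C))
     (fun t => 'i%C * D (b + al%:C + t%:C * 'i%C)) ('i%C * D s0) (e / 5) be.
  rewrite mul0r addr0; apply.
  - move=> t tbe; have [Ot _] := dP _ (near2 _ tbe).
    by have := g_line Ot; rewrite du_i.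
  - move=> t tbe; have [_] := dP _ (near2 _ tbe).
    rewrite -mulrBr normrM.
    by rewrite normc_i mul1r.
have h3 : `|D b - D s0| <= (e / 5)%:C.
  have [] // := dP b; rewrite (lt_le_trans bd)// lecR; lra.
have aE : b + al%:C + be%:C * 'i%C = a.
  by rewrite -addrA (mulrC _ 'i%C) -abE addrC subrK.
rewrite aE in h2.
have -> : g a - g b - D b * (a - b) =
  (g (b + al%:C) - g b - al%:C * D s0) +
  (g a - g (b + al%:C) - be%:C * ('i%C * D s0)) - (D b - D s0) * (a - b).
  by rewrite abE; move: (g a) (g b) (g _) (D s0) (D b) => *; ring.
rewrite (le_trans (ler_normB _ _))//.
(* Two fifths of [e] for each leg, one fifth for replacing [D s0] by [D b]. *)
have -> : e%:C * `|a - b| =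
   (2 * (e / 5))%:C * `|a - b| + (2 * (e / 5))%:C * `|a - b| + (e / 5)%:C * `|a - b|.
  by rewrite -!mulrDl -!rmorphD; congr (_%:C * _); field.
rewrite lerD//; last by rewrite normrM ler_wpM2r.
rewrite (le_trans (ler_normD _ _))// lerD//.
  rewrite (le_trans h1)// rmorphM ler_wpM2l// lecR mulr_ge0//; exact: ltW.
rewrite (le_trans h2)// rmorphM ler_wpM2l// lecR mulr_ge0//; exact: ltW.
Qed.

(** Compactness of the square [[- r, r]] by [[- r, r]] makes the local radii uniform. The square
    exceeds the disc of radius [r] but lies in the one of radius [2 * r], whence the hypothesis. *)
Lemma slice_uniformly_differentiable (r : R) :
  (forall s, `|s| <= (2 * r)%:C -> Omega (x + s *: v)) ->
  uniformly_differentiable_on_disc r%:C g D.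
Proof.
move=> Or _ /gt0_complexP[e e0 ->].
pose P (d : R) (p : R * R) := forall a, `|a - (p.1 +i* p.2)| < d%:C ->
  `|g a - g (p.1 +i* p.2) - D (p.1 +i* p.2) * (a - (p.1 +i* p.2))|
     <= e%:C * `|a - (p.1 +i* p.2)|.
have cK := compact_setX (@segment_compact R (- r) r) (@segment_compact R (- r) r).
have := iffLR (compact_near_coveringP _) cK R (0 : R)^'+ P _.
have pK (p : R * R) : (`[- r, r] `*` `[- r, r])%classic p ->
    `|p.1 +i* p.2| <= (2 * r)%:C.
  case: p => p1 p2 []; rewrite /= !in_itv/= => /andP[a1 a2] /andP[b1 b2].
  rewrite (le_trans (normc_le_ReIm _))//= lecR mulr_natl mulr2n.
  by rewrite lerD// ler_norml ?a1 ?a2 ?b1 ?b2.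
case=> [p /pK/Or Op|].
  have [d d0 dP] := slice_strictly_differentiable e0 Op.
  have d40 : 0 < d / 4 by rewrite divr_gt0.
  (* A point [q] of this ball is within [d / 2] of [p], and [a] is within [d / 2] of [q], so both
     are within [d] of [p]. *)
  exists (ball p (d / 4), [set d' | d' < d / 2]).
    by split; [exact: nbhsx_ballx|apply: nbhs_right_lt; rewrite divr_gt0].
  case=> -[q1 q2] d' [/= [/= q1d q2d] d'd] a /= ad.
  have qd : `|(q1 +i* q2) - (p.1 +i* p.2)| < (d / 2)%:C.
    rewrite (le_lt_trans (normc_le_ReIm _))//= ltcR.
    rewrite distrC (distrC q2) [X in _ < X](_ : _ = d / 4 + d / 4); last by field.
    by rewrite ltrD.
  apply: dP; last by rewrite (lt_trans qd)// ltcR; lra.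
  rewrite -[a - _](subrKA (q1 +i* q2)) (le_lt_trans (ler_normD _ _))//.
  rewrite (_ : d%:C = (d / 2)%:C + (d / 2)%:C); last by rewrite -rmorphD -splitr.
  by rewrite ltrD// (lt_trans ad)// ltcR.
move=> d d0 dP; exists (d / 2)%:C; first by rewrite ltcR divr_gt0.
move=> a b ar br abd.
have Kb : (`[- r, r] `*` `[- r, r])%classic (complex.Re b, complex.Im b).
  split; rewrite /= in_itv/= -ler_norml -lecR (le_trans _ br)//.
    exact: normc_ge_Re.
  exact: normc_ge_Im.
have hd : d / 2 \in `]0, d[.
  by rewrite in_itv/= divr_gt0//= ltr_pdivrMr// ltr_pMr// ltr1n.
have := dP (d / 2) _ _ _ Kb a.
have -> : complex.Re b +i* complex.Im b = b by case: (b).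
apply=> //.
  by rewrite /ball/= sub0r normrN gtr0_norm ?divr_gt0// ltr_pdivrMr// ltr_pMr// ltr1n.
by rewrite divr_gt0.
Qed.

End slices.

(** * Cauchy estimates in norm for bounded maps into a dual space *)

Section bounded_holomorphic.
Context {R : realType} {X Z : normedModType R[i]}.
Variables (Omega : set X) (u : X -> dual Z) (M : R).
Hypotheses (oO : open Omega) (uh : holomorphic Omega u).
Hypotheses (M0 : 0 <= M) (uM : forall x, Omega x -> `|u x| <= M%:C).

Section disc.
Variables (x v : X) (r : R).
Hypotheses (r0 : 0 < r).
Hypothesis Or : forall s : R[i], `|s| <= (2 * r)%:C -> Omega (x + s *: v).

Let evalM z (s : R[i]) : `|s| <= r%:C -> `|u (x + s *: v) z| <= M%:C * `|z|.
Proof.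
move=> sr; rewrite (le_trans (dual_eval_le _ _))// ler_wpM2r//.
apply/uM/Or.
by rewrite (le_trans sr)// lecR ler_peMl ?ler1n// ltW.
Qed.

Let r0C : (0 : R[i]) < r%:C. Proof. by rewrite ltcR. Qed.

Let half (s : R[i]) : `|s| <= (r / 2)%:C -> `|s| <= r%:C / 2.
Proof. by rewrite rmorphM fmorphV rmorph_nat. Qed.

(** Each evaluation at [z] is bounded by [M * |z|], so the scalar estimate has a constant
    proportional to [|z|] and passes to the operator norm. *)
Lemma dual_cauchy_lipschitz (s : R[i]) : `|s| <= (r / 2)%:C ->
  `|u (x + s *: v) - u x| <= (2 * M / r)%:C * `|s|.
Proof.
move=> sr; have [s' s'0 sE] := ge0_complexP (normr_ge0 s).
rewrite sE -rmorphM; apply: dual_norm_le; last first.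
  by rewrite mulr_ge0// divr_ge0 ?mulr_ge0// ltW.
move=> z; have := cauchy_lipschitz r0C
  (slice_uniformly_differentiable oO uh z Or) (evalM z) (half sr).
rewrite scale0r addr0 -dual_subE => /le_trans; apply.
by rewrite sE le_eqVlt; apply/orP; left; apply/eqP;
  rewrite !(rmorphM, fmorphV, rmorph_nat); ring.
Qed.

Lemma dual_cauchy_taylor2 (s : R[i]) : `|s| <= (r / 2)%:C ->
  `|u (x + s *: v) - u x - s *: du u x v| <= (4 * M / r ^+ 2)%:C * `|s| ^+ 2.
Proof.
move=> sr; have [s' s'0 sE] := ge0_complexP (normr_ge0 s).
rewrite sE -rmorphXn -rmorphM; apply: dual_norm_le; last first.
  by rewrite mulr_ge0 ?exprn_ge0// divr_ge0 ?mulr_ge0 ?exprn_ge0// ltW.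
move=> z; have := cauchy_taylor2 r0C
  (slice_uniformly_differentiable oO uh z Or) (evalM z) (half sr).
rewrite scale0r addr0 2!dual_subE dual_scaleE => /le_trans; apply.
by rewrite sE le_eqVlt; apply/orP; left; apply/eqP;
  rewrite !(rmorphM, rmorphXn, fmorphV, rmorph_nat); ring.
Qed.

(** The rate depends only on [M] and [r], hence is common to a whole bounded family and survives
    weak* limits. *)
Lemma diff_quotient_du_dist (e : R) : e != 0 -> `|e| <= r / 2 ->
  `|diff_quotient u x v e - du u x v| <= (4 * M / r ^+ 2 * `|e|)%:C.
Proof.
move=> e0 er; have eC : e%:C != 0 :> R[i] by rewrite (inj_eq (@complexI R)).
have ne : (0 : R[i]) < `|e%:C| by rewrite normr_gt0.
have -> : diff_quotient u x v e - du u x v =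
  (e%:C)^-1 *: (u (x + e%:C *: v) - u x - e%:C *: du u x v).
  by rewrite [RHS]scalerBr scalerA mulVf// scale1r.
rewrite normrZ normfV ler_pdivrMl// (le_trans (dual_cauchy_taylor2 _))//.
  by rewrite normc_real lecR.
rewrite normc_real -rmorphXn -!rmorphM lecR le_eqVlt; apply/orP; left.
by apply/eqP; ring.
Qed.

Lemma diff_quotient_le (e : R) : e != 0 -> `|e| <= r / 2 ->
  `|diff_quotient u x v e| <= (2 * M / r)%:C.
Proof.
move=> e0 er; have eC : e%:C != 0 :> R[i] by rewrite (inj_eq (@complexI R)).
have ne : (0 : R[i]) < `|e%:C| by rewrite normr_gt0.
rewrite normrZ normfV ler_pdivrMl// mulrC dual_cauchy_lipschitz//.
by rewrite normc_real lecR.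
Qed.

(** Compare [du] with the difference quotient at the largest admissible increment [r / 2]: the
    quotient and the error are each at most [2 * M / r]. *)
Lemma du_le : `|du u x v| <= (2 * M / r + 2 * M / r)%:C.
Proof.
have e0 : 0 < r / 2 by rewrite divr_gt0.
have en0 : r / 2 != 0 by rewrite gt_eqF.
have er : `|r / 2| <= r / 2 by rewrite gtr0_norm.
rewrite -[du u x v](subKr (diff_quotient u x v (r / 2))).
rewrite (le_trans (ler_normB _ _))// rmorphD lerD ?diff_quotient_le//.
rewrite (le_trans (diff_quotient_du_dist en0 er))// lecR gtr0_norm//.
by rewrite le_eqVlt; apply/orP; left; apply/eqP; field; rewrite gt_eqF.
Qed.

End disc.

(** Apply the estimate on the complex line through [q] and [y] at [s = 1], with radius
    [rho / (2 * |y - q|)]; the bound [rho / 4] is what makes 1 at most half this radius. *)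
Lemma locally_lipschitz (q : X) (rho : R) : 0 < rho ->
  (forall x, `|x - q| < (2 * rho)%:C -> Omega x) ->
  forall y, `|y - q| <= (rho / 4)%:C -> `|u y - u q| <= (4 * M / rho)%:C * `|y - q|.
Proof.
move=> rho0 Oq y yq; have [->|yq0] := eqVneq y q.
  by rewrite !subrr !normr0 mulr0.
have : 0 < `|y - q| by rewrite normr_gt0 subr_eq0.
move=> /gt0_complexP[B B0 BE].
have r0 : 0 < rho / (2 * B) by rewrite divr_gt0// mulr_gt0.
have Or (s : R[i]) : `|s| <= (2 * (rho / (2 * B)))%:C -> Omega (q + s *: (y - q)).
  move=> sr; apply: Oq; rewrite addrAC subrr add0r normrZ BE.
  apply: (@le_lt_trans _ _ ((2 * (rho / (2 * B)))%:C * B%:C)).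
    by rewrite ler_wpM2r// lecR ltW.
  rewrite -rmorphM ltcR (_ : 2 * (rho / (2 * B)) * B = rho); last by field; rewrite gt_eqF.
  by rewrite ltr_pMl// ltr1n.
have := @dual_cauchy_lipschitz q (y - q) _ r0 Or 1.
rewrite scale1r subrKC normr1 mulr1 BE -rmorphM.
rewrite (_ : 2 * M / (rho / (2 * B)) = 4 * M / rho * B); last by field; rewrite !gt_eqF.
apply; rewrite -(rmorph1 (real_complex R)) lecR.
move: yq; rewrite BE lecR => yq.
rewrite (_ : rho / (2 * B) / 2 = (rho / 4) / B); last by field; rewrite gt_eqF.
by rewrite ler_pdivlMr// mul1r.
Qed.

End bounded_holomorphic.

(** One radius [rho / (2 * B)] serves all base points near [q] and all directions bounded by [B], as
    joint continuity of the differential requires. *)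
Lemma line_sub_ball (R : realType) (X : normedModType R[i]) (q x v : X)
    (rho B : R) (s : R[i]) :
  0 < B -> `|x - q| < rho%:C -> `|v| <= B%:C ->
  `|s| <= (2 * (rho / (2 * B)))%:C -> `|x + s *: v - q| < (2 * rho)%:C.
Proof.
move=> B0 xq vB sr; rewrite addrAC (le_lt_trans (ler_normD _ _))//.
rewrite mulr_natl mulr2n rmorphD ltr_leD// normrZ.
apply: (@le_trans _ _ ((2 * (rho / (2 * B)))%:C * B%:C)).
  by rewrite ler_pM.
by rewrite -rmorphM lecR (_ : 2 * (rho / (2 * B)) * B = rho)//; field; rewrite gt_eqF.
Qed.

(** * Weak* limits along an ultrafilter *)

Lemma norm_cvg_le (R : realType) (V : normedModType R[i]) (T : Type)
    (F : set_system T) {FF : ProperFilter F} (f : T -> V) (l : V) (c : R[i]) :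
  f @ F --> l -> (\forall t \near F, `|f t| <= c) -> `|l| <= c.
Proof.
move=> fl fc; apply/ler_addgt0Pr => e e0.
have le : \forall t \near F, `|l - f t| < e by exact: cvgr_dist_lt.
have [t [lt ct]] := filter_ex (filterI le fc).
by rewrite -(subrK (f t) l) (le_trans (ler_normD _ _))// addrC lerD// ltW.
Qed.

Lemma ultra_fmap (T U : Type) (F : set_system T) (f : T -> U) :
  UltraFilter F -> UltraFilter (f @ F).
Proof.
move=> UF; split; first exact: fmap_proper_filter.
move=> G PG FG; apply/seteqP; split=> // A GA.
have [//|FnA] := in_ultra_setVsetC (f @^-1` A) UF.
have /filter_ex[u []//] : G (A `&` ~` A).
by apply: filterI => //; exact: FG.
Qed.

Section ultralimits.
Context {R : realType} {Z : normedModType R[i]} {T : Type} {F : set_system T}.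
Context {UF : UltraFilter F}.

Lemma ultra_bounded_cvg_real (a : T -> R) (M : R) :
  (forall t, `|a t| <= M) -> exists l : R, a @ F --> l.
Proof.
move=> aM; have := @segment_compact R (- M) M; rewrite compact_ultra.
move=> /(_ _ (ultra_fmap a UF))[].
  apply: (@filterE _ F) => t; rewrite /= in_itv/= -ler_norml; exact: aM.
by move=> l [_ al]; exists l.
Qed.

Lemma ultra_bounded_cvg (a : T -> R[i]^o) (M : R) :
  (forall t, `|a t| <= M%:C) -> exists l : R[i]^o, a @ F --> l.
Proof.
move=> aM.
have [|r ar] := @ultra_bounded_cvg_real (fun t => complex.Re (a t)) M.
  by move=> t; rewrite -lecR (le_trans (normc_ge_Re _)) ?aM.
have [|s as_] := @ultra_bounded_cvg_real (fun t => complex.Im (a t)) M.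
  by move=> t; rewrite -lecR (le_trans (normc_ge_Im _)) ?aM.
by exists (r +i* s); exact: cvg_complex.
Qed.

(** Tested on each vector, so that limits of differences and multiples reduce to scalar limits. *)
Definition weakstar_lim (y : T -> dual Z) (l : dual Z) : Prop :=
  forall z, (fun t => y t z : R[i]^o) @ F --> (l z : R[i]^o).

Lemma weakstar_limB y1 y2 l1 l2 : weakstar_lim y1 l1 -> weakstar_lim y2 l2 ->
  weakstar_lim (fun t => y1 t - y2 t) (l1 - l2).
Proof. by move=> h1 h2 z; apply: cvgB; [exact: h1|exact: h2]. Qed.

Lemma weakstar_limZ (a : R[i]) y l :
  weakstar_lim y l -> weakstar_lim (fun t => a *: y t) (a *: l).
Proof. by move=> h z; apply: (@cvgZl_tmp _ R[i]^o); exact: h. Qed.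

Lemma weakstar_lim_unique y l1 l2 :
  weakstar_lim y l1 -> weakstar_lim y l2 -> l1 = l2.
Proof.
move=> h1 h2; apply/val_inj/funext => z /=.
exact: (@cvg_unique R[i]^o (@norm_hausdorff _ R[i]^o) _ _ _ _ (h1 z) (h2 z)).
Qed.

(** Closed balls of the dual are weak* closed; this carries every norm estimate to the limit. *)
Lemma weakstar_lim_norm_le y l (M : R) : 0 <= M ->
  (\forall t \near F, `|y t| <= M%:C) -> weakstar_lim y l -> `|l| <= M%:C.
Proof.
move=> M0 yM yl; apply: dual_norm_le => // z.
apply: (norm_cvg_le (yl z)); apply: filterS yM => t yM.
by rewrite (le_trans (dual_eval_le _ _))// ler_wpM2r.
Qed.

(** Bounded scalars converge along an ultrafilter, so the limit exists pointwise; it is linear by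
    uniqueness of limits and continuous by the common bound. *)
Lemma banach_alaoglu_ultra (y : T -> dual Z) (M : R) : 0 <= M ->
  (forall t, `|y t| <= M%:C) -> exists l, weakstar_lim y l.
Proof.
move=> M0 yM.
have /choice[l yl] : forall z, exists c : R[i]^o,
    (fun t => y t z : R[i]^o) @ F --> c.
  move=> z; have [m m0 mE] := ge0_complexP (normr_ge0 z).
  apply: (@ultra_bounded_cvg _ (M * m)) => t.
  have -> : (M * m)%:C = M%:C * `|z| by rewrite mE rmorphM.
  by rewrite (le_trans (dual_eval_le _ _))// ler_wpM2r.
have l_lin : linear l.
  move=> a x1 x2.
  apply: (@cvg_unique R[i]^o (@norm_hausdorff _ R[i]^o) _ _ _ _ (yl _)).
  have h : (fun t => a *: (y t x1 : R[i]^o) + (y t x2 : R[i]^o)) @ F -->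
     a *: (l x1 : R[i]^o) + (l x2 : R[i]^o).
    by apply: cvgD; [apply: cvgZl_tmp|]; exact: yl.
  by apply: cvg_trans h; apply: near_eq_cvg; near=> t; rewrite linearP.
have lM z : `|l z| <= M%:C * `|z|.
  apply: (norm_cvg_le (yl z)); near=> t.
  by rewrite (le_trans (dual_eval_le _ _))// ler_wpM2r.
have l_cont : continuous l.
  move=> x1; apply/cvgrPdist_lt => e e0.
  have M1 : (0 : R[i]) < (M + 1)%:C by rewrite ltcR ltr_wpDl.
  near=> x2.
  have -> : l x1 - l x2 = l (x1 - x2).
    have -> : x1 - x2 = -1 *: x2 + x1 by rewrite scaleN1r addrC.
    by rewrite l_lin scaleN1r addrC.
  rewrite (le_lt_trans (lM _))//.
  rewrite (@le_lt_trans _ _ ((M + 1)%:C * `|x1 - x2|))//.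
    by rewrite ler_wpM2r// lecR lerDl.
  rewrite mulrC -ltr_pdivlMr//; near: x2; apply: cvgr_dist_lt => //.
  by rewrite divr_gt0.
have lP : l \in dual_pred (Z := Z) by apply/asboolP.
by exists (Dual lP).
Unshelve. all: by end_near. Qed.

End ultralimits.
Arguments weakstar_lim {R Z T} F y l.

Lemma open_real_ball (R : realType) (X : normedModType R[i]) (Omega : set X)
    (q : X) : open Omega -> Omega q ->
  exists2 rho : R, 0 < rho & forall x, `|x - q| < (2 * rho)%:C -> Omega x.
Proof.
move=> oO Oq; have /nbhs_ballP[_ /= /gt0_complexP[d d0 ->] dO] : nbhs q Omega.
  exact: open_nbhs_nbhs.
exists (d / 2) => [|x xq]; first by rewrite divr_gt0.
apply: dO; rewrite -ball_normE /ball_/= distrC (lt_le_trans xq)// lecR.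
by rewrite mulrC divfK.
Qed.

(** * Holomorphy of a weak* limit of bounded holomorphic maps *)

Section limit_holomorphic.
Context {R : realType} {X Z : normedModType R[i]} {T : Type} {F : set_system T}.
Context {UF : UltraFilter F}.
Variables (Omega : set X) (u : T -> X -> dual Z) (f : X -> dual Z) (M : R).
Hypotheses (oO : open Omega) (uh : forall t, holomorphic Omega (u t)).
Hypotheses (M0 : 0 <= M).
Hypothesis uM : forall t x, Omega x -> `|u t x| <= M%:C.
Hypothesis uf : forall x, weakstar_lim F (u^~ x) (f x).

Let ge0_div (k r : R) : 0 <= k -> 0 < r -> 0 <= k * M / r.
Proof. by move=> k0 r0; rewrite divr_ge0 ?mulr_ge0// ltW. Qed.

Let disc_in (q x v : X) (rho B : R) :
    (forall x, `|x - q| < (2 * rho)%:C -> Omega x) ->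
    0 < B -> `|x - q| < rho%:C -> `|v| <= B%:C ->
  forall s : R[i], `|s| <= (2 * (rho / (2 * B)))%:C -> Omega (x + s *: v).
Proof. by move=> rO B0 xq vB s sr; apply: rO; exact: line_sub_ball sr. Qed.

(** The condition on [q] stands under the existential so that the limit can be chosen as a total
    function [L], with an arbitrary value off [Omega]. *)
Let du_cvg_ex q v : exists l, Omega q -> weakstar_lim F (fun t => du (u t) q v) l.
Proof.
have [Oq|nOq] := pselect (Omega q); last by exists 0.
have [rho rho0 rO] := open_real_ball oO Oq.
have [B B0 BE] := ge0_complexP (normr_ge0 v).
have B1 : 0 < B + 1 by rewrite ltr_wpDl.
have vB : `|v| <= (B + 1)%:C by rewrite BE lecR lerDl.
have qq : `|q - q| < rho%:C by rewrite subrr normr0 ltcR.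
have r0 : 0 < rho / (2 * (B + 1)) by rewrite divr_gt0// mulr_gt0.
have [|t|l ul] := @banach_alaoglu_ultra R Z T F UF (fun t => du (u t) q v)
  (2 * M / (rho / (2 * (B + 1))) + 2 * M / (rho / (2 * (B + 1)))); last by exists l.
  by rewrite addr_ge0// ge0_div.
exact: (du_le oO (uh t) M0 (uM t) r0 (disc_in rO B1 qq vB)).
Qed.

Let L q v : dual Z := projT1 (cid (du_cvg_ex q v)).

Let uL q v : Omega q -> weakstar_lim F (fun t => du (u t) q v) (L q v).
Proof. exact: (projT2 (cid (du_cvg_ex q v))). Qed.

(** The estimate common to all [u t] passes to the weak* limit; it makes [L] a derivative of [f] in
    norm although [f] is only a weak* limit. *)
Let diff_quotient_L (x v : X) (r : R) : 0 < r ->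
  (forall s : R[i], `|s| <= (2 * r)%:C -> Omega (x + s *: v)) ->
  forall e : R, e != 0 -> `|e| <= r / 2 ->
  `|diff_quotient f x v e - L x v| <= (4 * M / r ^+ 2 * `|e|)%:C.
Proof.
move=> r0 Or e e0 er.
have Ox : Omega x.
  rewrite -[x]addr0 -(scale0r v); apply: Or.
  by rewrite normr0 lecR mulr_ge0// ltW.
apply: (@weakstar_lim_norm_le _ _ _ F _
  (fun t => diff_quotient (u t) x v e - du (u t) x v)).
- by rewrite mulr_ge0// ge0_div ?exprn_gt0.
- by apply: filterE => t; exact: (diff_quotient_du_dist oO (uh t) M0 (uM t)).
- apply: weakstar_limB; last exact: uL.
  by apply: weakstar_limZ; apply: weakstar_limB; exact: uf.
Qed.

Let cvg_L (q v : X) : Omega q ->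
  diff_quotient f q v e @[e --> (0 : R)^'] --> L q v.
Proof.
move=> Oq; have [rho rho0 rO] := open_real_ball oO Oq.
have [B B0 BE] := ge0_complexP (normr_ge0 v).
have B1 : 0 < B + 1 by rewrite ltr_wpDl.
have vB : `|v| <= (B + 1)%:C by rewrite BE lecR lerDl.
have qq : `|q - q| < rho%:C by rewrite subrr normr0 ltcR.
set r := rho / (2 * (B + 1)).
have r0 : 0 < r by rewrite divr_gt0// mulr_gt0.
have Or := disc_in rO B1 qq vB.
set c := 4 * M / r ^+ 2.
have c0 : 0 <= c by rewrite ge0_div ?exprn_gt0.
have c1 : 0 < c + 1 by rewrite ltr_wpDl.
apply/cvgrPdist_lt => _ /gt0_complexP[e e0 ->].
near=> t.
have t0 : t != 0 by near: t; exact: nbhs_dnbhs_neq.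
have tr : `|t| <= r / 2 by near: t; apply: dnbhs0_le; rewrite divr_gt0.
rewrite distrC (le_lt_trans (diff_quotient_L r0 Or t0 tr))// ltcR -/c.
apply: (@le_lt_trans _ _ ((c + 1) * `|t|)).
  by rewrite ler_wpM2r// lerDl.
rewrite mulrC -ltr_pdivlMr//.
by near: t; apply: dnbhs0_lt; rewrite divr_gt0.
Unshelve. all: by end_near. Qed.

Let du_L (q v : X) : Omega q -> du f q v = L q v.
Proof.
by move=> Oq; apply: cvg_lim; [exact: norm_hausdorff|exact: cvg_L].
Qed.

Lemma limit_locally_lipschitz (q : X) (rho : R) : 0 < rho ->
  (forall x, `|x - q| < (2 * rho)%:C -> Omega x) ->
  forall y, `|y - q| <= (rho / 4)%:C -> `|f y - f q| <= (4 * M / rho)%:C * `|y - q|.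
Proof.
move=> rho0 rO y yq; have [B B0 BE] := ge0_complexP (normr_ge0 (y - q)).
rewrite BE -rmorphM; apply: (@weakstar_lim_norm_le _ _ _ F _
  (fun t => u t y - u t q)).
- by rewrite mulr_ge0// ge0_div.
- apply: filterE => t; rewrite [X in _ <= X]rmorphM /= -[B%:C]BE.
  exact: (locally_lipschitz oO (uh t) M0 (uM t)).
- by apply: weakstar_limB; exact: uf.
Qed.

Let continuous_f (q : X) : Omega q -> {for q, continuous f}.
Proof.
move=> Oq; have [rho rho0 rO] := open_real_ball oO Oq.
set c := 4 * M / rho.
have c0 : 0 <= c by rewrite ge0_div.
have c1 : (0 : R[i]) < (c + 1)%:C by rewrite ltcR ltr_wpDl.
apply/cvgrPdist_lt => e e0; near=> y.
rewrite distrC; apply: le_lt_trans (limit_locally_lipschitz rho0 rO _) _.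
  rewrite distrC ltW//; near: y; apply: cvgr_dist_lt; first exact: cvg_id.
  by rewrite ltcR divr_gt0.
apply: (@le_lt_trans _ _ ((c + 1)%:C * `|y - q|)).
  by rewrite ler_wpM2r// lecR lerDl.
rewrite mulrC -ltr_pdivlMr// distrC.
by near: y; apply: cvgr_dist_lt; [exact: cvg_id|rewrite divr_gt0].
Unshelve. all: by end_near. Qed.

(** Near [(q, v)] the differential is a uniform limit of difference quotients of [f], each
    continuous in the point and the direction. *)
Let continuous_L (q v : X) : Omega q ->
  {for (q, v), continuous (fun qv : X * X => du f qv.1 qv.2)}.
Proof.
move=> Oq; have [rho rho0 rO] := open_real_ball oO Oq.
have [B B0 BE] := ge0_complexP (normr_ge0 v).
have B1 : 0 < B + 1 by rewrite ltr_wpDl.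
have vB : `|v| <= (B + 1)%:C by rewrite BE lecR lerDl.
have qq : `|q - q| < rho%:C by rewrite subrr normr0 ltcR.
set r := rho / (2 * (B + 1)).
have r0 : 0 < r by rewrite divr_gt0// mulr_gt0.
set c := 4 * M / r ^+ 2.
have c0 : 0 <= c by rewrite ge0_div ?exprn_gt0.
have c1 : 0 < c + 1 by rewrite ltr_wpDl.
apply/cvgrPdist_lt => _ /gt0_complexP[e e0 ->].
(* One fixed increment: the quotient is within [e / 4] of the differential at [(q, v)] and at all
   nearby pairs, leaving [e / 2] for the continuity of the quotient. *)
pose s := Num.min (r / 2) (e / (4 * (c + 1))).
have s0 : 0 < s by rewrite lt_min !divr_gt0// mulr_gt0.
have sn0 : s != 0 by rewrite gt_eqF.
have sr : `|s| <= r / 2 by rewrite gtr0_norm// ge_min lexx.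
have cs : c * `|s| <= e / 4.
  rewrite gtr0_norm// (@le_trans _ _ ((c + 1) * s))//.
    by rewrite ler_wpM2r ?lerDl// ltW.
  rewrite mulrC -ler_pdivlMr// (@le_trans _ _ (e / (4 * (c + 1))))//.
    by rewrite ge_min lexx orbT.
  by rewrite le_eqVlt; apply/orP; left; apply/eqP; field; rewrite gt_eqF.
have cQ : (fun xw : X * X => diff_quotient f xw.1 xw.2 s) @ nbhs (q, v) -->
    diff_quotient f q v s.
  have c_1 : (fun xw : X * X => xw.1) @ nbhs (q, v) --> q by exact: cvg_fst.
  have c_2 : (fun xw : X * X => xw.2) @ nbhs (q, v) --> v by exact: cvg_snd.
  apply: (@cvgZl_tmp _ (dual Z)); apply: cvgB.
    apply: (@cvg_comp _ _ _ (fun xw : X * X => xw.1 + s%:C *: xw.2) f _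
      (nbhs (q + s%:C *: v))).
      by apply: cvgD => //; apply: cvgZl_tmp.
    apply: continuous_f; apply: (disc_in rO B1 qq vB).
    rewrite normc_real lecR (le_trans sr)//.
    by rewrite ler_pdivrMr// -/r mulrAC ler_peMl// ?ltW//; lra.
  by apply: (@cvg_comp _ _ _ fst f _ (nbhs q)) => //; exact: continuous_f.
near=> xw.
have xq : `|xw.1 - q| < rho%:C.
  rewrite distrC; near: xw; apply: cvgr_dist_lt; last by rewrite ltcR.
  exact: cvg_fst.
have wB : `|xw.2| <= (B + 1)%:C.
  rewrite ltW//; near: xw; apply: (@cvgr_norm_lt _ _ _ _ _ _ v).
    exact: cvg_snd.
  by rewrite BE ltcR ltrDl.
have Ox : Omega xw.1.
  by apply: rO; rewrite (lt_trans xq)// ltcR ltr_pMl// ltr1n.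
rewrite /= !du_L//.
have -> : L q v - L xw.1 xw.2 =
  - (diff_quotient f q v s - L q v) +
  (diff_quotient f xw.1 xw.2 s - L xw.1 xw.2) +
  (diff_quotient f q v s - diff_quotient f xw.1 xw.2 s).
  by rewrite opprB addrAC !subrKA.
have -> : e%:C = (e / 4)%:C + (e / 4)%:C + (e / 2)%:C.
  by rewrite -!rmorphD; congr _%:C; field.
rewrite (le_lt_trans (ler_normD _ _))// ler_ltD//.
  rewrite (le_trans (ler_normD _ _))// normrN lerD//.
    by rewrite (le_trans (diff_quotient_L r0 (disc_in rO B1 qq vB) sn0 sr))// lecR.
  by rewrite (le_trans (diff_quotient_L r0 (disc_in rO B1 xq wB) sn0 sr))// lecR.
by near: xw; apply: cvgr_dist_lt => //; rewrite ltcR divr_gt0.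
Unshelve. all: by end_near. Qed.

Lemma weakstar_limit_holomorphic : holomorphic Omega f.
Proof.
split; first split.
- by move=> q v Oq; apply/cvg_ex; exists (L q v); exact: cvg_L.
- rewrite continuous_open_subspace; last exact: open_setXT.
  by case=> q v; rewrite inE => -[Oq _]; exact: continuous_L.
move=> q v Oq; rewrite /Dbar !du_L//.
have -> : L q ('i%C *: v) = 'i%C *: L q v.
  have iuL : weakstar_lim F (fun t => du (u t) q ('i%C *: v)) ('i%C *: L q v).
    rewrite (_ : (fun t => _) = fun t => 'i%C *: du (u t) q v); last first.
      by apply/funext => t; rewrite (du_i (uh t)).
    by apply: weakstar_limZ; exact: uL.
  exact: weakstar_lim_unique (@uL q ('i%C *: v) Oq) iuL.
by rewrite scalerA -expr2 sqr_i scaleN1r subrr scaler0.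
Qed.

End limit_holomorphic.

(** * Convergence of a subsequence *)

(** The second premise is the unfolded form of [open U] in a sub-base topology, a union of finite
    intersections, so a finite intersection of events of [G] is enough. *)
Lemma open_subbase_near (T S : Type) (I : choiceType) (D : set I)
    (b : I -> set T) (G : set_system S) (g : S -> T) (y : T) (U : set T) :
  Filter G ->
  (exists2 C, C `<=` finI_from D b & \bigcup_(A in C) id A = U) ->
  (forall i, D i -> b i y -> \forall s \near G, b i (g s)) ->
  U y -> \forall s \near G, U (g s).
Proof.
move=> FG [D' D'D <-] bG [A D'A Ay]; have [E ED EA] := D'D _ D'A.
apply: filterS (@filter_bigI _ _ E (fun i => g @^-1` b i) G FG _) => [s sE|i iE].
  by exists A => //; rewrite -EA => i iE; exact: sE.
apply: bG; first exact/set_mem/ED.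
by move: Ay; rewrite -EA; exact.
Qed.

Lemma weakstar_open_near (R : realType) (Z : normedModType R[i]) (S : Type)
    (G : set_system S) (g : S -> dual Z) (y : dual Z) (U : set (weakstar Z)) :
  Filter G -> (forall z, (fun s => g s z : R[i]^o) @ G --> (y z : R[i]^o)) ->
  open U -> U y -> \forall s \near G, U (g s).
Proof.
move=> FG gy oU; apply: (open_subbase_near FG oU) => _ [z [V [oV ->]]] Vy.
by apply: gy; exact: open_nbhs_nbhs.
Qed.

Lemma cwso_cvg (R : realType) (X Z : normedModType R[i]) (Omega : set X)
    (S : Type) (G : set_system S) (g : S -> cwso Z Omega) (f : cwso Z Omega) :
  Filter G ->
  (forall (K : set X) (U : set (weakstar Z)), compact K -> K `<=` Omega ->
    open U -> (forall x, K x -> U ((f : holo (dual Z) Omega) x)) ->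
    \forall s \near G, forall x, K x -> U ((g s : holo (dual Z) Omega) x)) ->
  g @ G --> f.
Proof.
move=> FG gK A; rewrite nbhsE => -[V [oV Vf] VA].
suff : \forall s \near G, V (g s) by apply: filterS => s; exact: VA.
apply: (open_subbase_near FG oV) Vf => _ [K [U [cK KO oU ->]]] /= fK.
apply: filterS (gK K U cK KO oU _) => [s sU _ [x Kx <-]|x Kx]; first exact: sU.
by apply: fK; exists x.
Qed.

Lemma separable_sequence (R : realType) (X : normedModType R[i]) :
  separable_space X -> exists d : nat -> X,
    forall x (e : R[i]), 0 < e -> exists k, `|x - d k| < e.
Proof.
move=> [D /countable_injP[h hinj] dD].
have /choice[d dP] : forall k, exists y, forall x, D x -> h x = k -> y = x.
  move=> k; have [[y [Dy hy]]|no] := pselect (exists y, D y /\ h y = k).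
    by exists y => x Dx hx; apply: hinj; [exact: mem_set|exact: mem_set|rewrite hx].
  (* Indices that [h] does not reach from [D] get the default value 0. *)
  by exists 0 => x Dx hx; case: no; exists x.
exists d => x e e0.
have [|y [xy Dy]] := dD (ball x e) _ (ball_open x e).
  by exists x; exact: ballxx.
by exists (h y); rewrite (dP _ _ Dy erefl); move: xy; rewrite -ball_normE.
Qed.

(** Every [P k] meets every tail, as both belong to the proper filter [F]. Countably many properties
    that hold along [F] thus hold along an ordinary subsequence. *)
Lemma filter_subsequence (F : set_system nat) (P : nat -> set nat) :
  ProperFilter F -> \oo `<=` F -> (forall k, F (P k)) ->
  exists phi : nat -> nat,
    {homo phi : m n / (m < n)%N} /\ forall k, P k (phi k).
Proof.
move=> PF ooF FP.
have /choice[h hP] : forall kN : nat * nat, exists n, P kN.1 n /\ (kN.2 < n)%N.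
  case=> k N; have : F (P k `&` [set n | (N < n)%N]).
    by apply: filterI; [exact: FP|apply: ooF; exists N.+1].
  by move=> /filter_ex[n []]; exists n.
pose phi := fix phi k := if k is k'.+1 then h (k, phi k') else h (0%N, 0%N).
exists phi; split; last first.
  by case=> [|k]; [exact: (hP (0, 0)%N).1|exact: (hP (k.+1, phi k)).1].
apply: homo_ltn; first exact: ltn_trans.
by move=> k; have [] := hP (k.+1, phi k).
Qed.

(** * Equicontinuity and uniform convergence on compact sets *)

Section joint_convergence.
Context {R : realType} {X Z : normedModType R[i]}.
Variables (Omega : set X) (u : nat -> X -> dual Z) (f : X -> dual Z) (M : R).
Variables (d : nat -> X) (e : nat -> Z).
Hypotheses (oO : open Omega) (M0 : 0 <= M).
Hypothesis uM : forall n x, `|u n x| <= M%:C.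
Hypothesis fM : forall x, `|f x| <= M%:C.
Hypothesis u_lip : forall n q rho, 0 < rho ->
  (forall x, `|x - q| < (2 * rho)%:C -> Omega x) ->
  forall y, `|y - q| <= (rho / 4)%:C -> `|u n y - u n q| <= (4 * M / rho)%:C * `|y - q|.
Hypothesis f_lip : forall q rho, 0 < rho ->
  (forall x, `|x - q| < (2 * rho)%:C -> Omega x) ->
  forall y, `|y - q| <= (rho / 4)%:C -> `|f y - f q| <= (4 * M / rho)%:C * `|y - q|.
Hypothesis d_dense : forall x (eps : R[i]), 0 < eps -> exists k, `|x - d k| < eps.
Hypothesis e_dense : forall x (eps : R[i]), 0 < eps -> exists k, `|x - e k| < eps.
Hypothesis u_cvg : forall i j,
  (fun n => u n (d i) (e j) : R[i]^o) @ \oo --> (f (d i) (e j) : R[i]^o).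

(** The common Lipschitz bound near [q] and the common bound [M] reduce the claim to one pair of
    dense indices, where [u_cvg] applies. The limit is taken over the point and the index together,
    to be combined with compactness. *)
Lemma joint_weakstar_cvg q z : Omega q ->
  (fun p : X * nat => u p.2 p.1 z : R[i]^o) @ filter_prod (nbhs q) \oo -->
  (f q z : R[i]^o).
Proof.
move=> Oq; have [rho rho0 rO] := open_real_ball oO Oq.
apply/cvgrPdist_lt => _ /gt0_complexP[eps eps0 ->].
have [m m0 mE] := ge0_complexP (normr_ge0 z).
pose c := 4 * M / rho.
have c0 : 0 <= c by rewrite divr_ge0 ?mulr_ge0// ltW.
pose cm := (c + 1) * (m + 1).
have cm0 : 0 < cm by rewrite mulr_gt0// ltr_wpDl.
(* Within [del] of [q] the Lipschitz estimate holds, and moving the point changes the value at [z]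
   by less than [eps / 6], [cm] bounding the Lipschitz constant times [|z|]. *)
pose del := Num.min (rho / 4) (eps / 6 / cm).
have eps6 : 0 < eps / 6 by rewrite divr_gt0.
have del0 : 0 < del by rewrite lt_min !divr_gt0.
have lip (g : X -> dual Z) : (forall y, `|y - q| <= (rho / 4)%:C ->
      `|g y - g q| <= c%:C * `|y - q|) ->
    forall y, `|q - y| < del%:C -> `|g y z - g q z| < (eps / 6)%:C.
  move=> gl y yq; rewrite -dual_subE (le_lt_trans (dual_eval_le _ _))// mE.
  have dr : del%:C <= (rho / 4)%:C by rewrite lecR ge_min lexx.
  have de : del <= eps / 6 / cm by rewrite ge_min lexx orbT.
  rewrite distrC in yq.
  apply: (@le_lt_trans _ _ (c%:C * `|y - q| * m%:C)).
    by rewrite ler_wpM2r ?lecR// gl// (le_trans (ltW yq)).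
  have [t t0 tE] := ge0_complexP (normr_ge0 (y - q)).
  rewrite tE -!rmorphM ltcR; rewrite tE ltcR in yq.
  rewrite ler_pdivlMr// in de.
  have : c * t * m <= cm * t.
    rewrite /cm mulrAC ler_wpM2r// ler_pM// lerDl//.
  move=> /le_lt_trans; apply; rewrite (lt_le_trans _ de)//.
  by rewrite mulrC ltr_pM2r.
have [i qi] : exists i, `|q - d i| < del%:C by apply: d_dense; rewrite ltcR.
have [j zj] : exists j, `|z - e j| < (eps / 6 / (M + 1))%:C.
  by apply: e_dense; rewrite ltcR divr_gt0// ltr_wpDl.
have ev (y : dual Z) : `|y| <= M%:C -> `|y z - y (e j)| < (eps / 6)%:C.
  move=> yM; rewrite -linearB (le_lt_trans (dual_eval_le _ _))//.
  apply: (@le_lt_trans _ _ ((M + 1)%:C * `|z - e j|)).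
    by rewrite ler_wpM2r// (le_trans yM)// lecR lerDl.
  have -> : (eps / 6)%:C = (M + 1)%:C * (eps / 6 / (M + 1))%:C.
    by rewrite -rmorphM; congr _%:C; field; rewrite gt_eqF// ltr_wpDl.
  by rewrite ltr_pM2l// ltcR ltr_wpDl.
have uij : \forall n \near \oo, `|f (d i) (e j) - u n (d i) (e j)| < (eps / 6)%:C.
  by apply: cvgr_dist_lt; [exact: u_cvg|rewrite ltcR].
exists ([set x | `|q - x| < del%:C],
        [set n | `|f (d i) (e j) - u n (d i) (e j)| < (eps / 6)%:C]) => /=.
  by split=> //; apply: cvgr_dist_lt; [exact: cvg_id|rewrite ltcR].
case=> x n [/= qx un].
(* The chain moves [q] to [d i], [z] to [e j], passes from [f] to [u n], then goes back to [z], to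
   [q], and on to [x]. *)
have -> : f q z - u n x z =
  - (f (d i) z - f q z) + (f (d i) z - f (d i) (e j)) +
  (f (d i) (e j) - u n (d i) (e j)) - (u n (d i) z - u n (d i) (e j)) +
  (u n (d i) z - u n q z) - (u n x z - u n q z) by ring.
have -> : eps%:C = (eps / 6)%:C + (eps / 6)%:C + (eps / 6)%:C + (eps / 6)%:C +
    (eps / 6)%:C + (eps / 6)%:C.
  by rewrite -!rmorphD; congr _%:C; field.
rewrite (le_lt_trans (ler_normB _ _))// ltrD ?(lip _ (u_lip n rho0 rO))//.
rewrite (le_lt_trans (ler_normD _ _))// ltrD ?(lip _ (u_lip n rho0 rO))//.
rewrite (le_lt_trans (ler_normB _ _))// ltrD ?ev//.
rewrite (le_lt_trans (ler_normD _ _))// ltrD//.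
by rewrite (le_lt_trans (ler_normD _ _))// normrN ltrD ?ev// (lip _ (f_lip rho0 rO)).
Qed.

(** Each [x] in [K] has a neighbourhood and a tail of indices that work together; compactness gives
    a single tail for all of [K]. *)
Lemma compact_weakstar_near (K : set X) (U : set (weakstar Z)) :
  compact K -> K `<=` Omega -> open U -> (forall x, K x -> U (f x)) ->
  \forall n \near \oo, forall x, K x -> U (u n x).
Proof.
move=> /compact_near_coveringP cK KO oU fU.
apply: (cK nat \oo (fun n x => U (u n x))) => x Kx.
have cvx z := @joint_weakstar_cvg x z (KO x Kx).
have FG : Filter (filter_prod (nbhs x) \oo) by exact: filter_prod_filter.
exact: (weakstar_open_near FG cvx oU (fU x Kx)).
Qed.

End joint_convergence.

Theorem theorem6p1 (R : realType) (X Z : completeNormedModType R[i])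
    (Omega : set X) (W : set (dual Z)) :
  separable_space X -> is_domain Omega ->
  separable_space Z -> has_schauder_basis Z ->
  is_domain W -> bounded_set W ->
  normal_family (holo_into Omega W).
Proof.
move=> sX [oO _] sZ _ _ bW u uW.
have [d d_dense] := separable_sequence sX.
have [e e_dense] := separable_sequence sZ.
have [M M0 WM] : exists2 M : R, 0 <= M & forall y, W y -> `|y| <= M%:C.
  have [_/gt0_complexP[M Mgt0 ->] WM] := pinfty_ex_gt0 bW.
  by exists M; [exact: ltW|].
pose v n : X -> dual Z := (u n : holo (dual Z) Omega).
have vh n : holomorphic Omega (v n) by rewrite /v; case: (u n).
have v0 n x : ~ Omega x -> v n x = 0 by rewrite /v; case: (u n) => g gh g0 /=; exact: g0.
have vM n x : `|v n x| <= M%:C.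
  have [Ox|/v0 ->] := pselect (Omega x); last by rewrite normr0 lecR.
  by apply: WM; apply: uW; exists x.
(* The ultrafilter supplies the limit [f] at all points at once, before any subsequence is
   chosen. *)
have [F [UF ooF]] := ultraFilterLemma (eventually_filter).
have /choice[f vf] : forall x, exists l, weakstar_lim F (v^~ x) l.
  by move=> x; apply: (@banach_alaoglu_ultra _ _ _ F UF _ M).
have f0 x : ~ Omega x -> f x = 0.
  move=> nOx; apply: weakstar_lim_unique (vf x) _.
  rewrite (_ : v^~ x = cst 0); first by move=> z; exact: cvg_cst.
  by apply/funext => n; exact: v0.
have fM x : `|f x| <= M%:C.
  by apply: (weakstar_lim_norm_le M0 _ (vf x)); apply: filterE => n; exact: vM.
have fh : holomorphic Omega f.
  exact: (weakstar_limit_holomorphic oO vh M0 (fun n x _ => vM n x) vf).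
have f_lip := @limit_locally_lipschitz _ _ _ _ F UF _ _ _ _ oO vh M0 (fun n x _ => vM n x) vf.
(* [P k] asks for precision [1 / (k + 1)] on the first [k + 1] dense points and vectors: finitely
   many conditions, hence an event of [F]. *)
pose P k : set nat := [set n | forall ij : 'I_k.+1 * 'I_k.+1,
  `|f (d ij.1) (e ij.2) - v n (d ij.1) (e ij.2)| < (k.+1%:R^-1)%:C].
have FP k : F (P k).
  apply: filter_forall => -[i j] /=; apply: cvgr_dist_lt; first exact: vf.
  by rewrite ltcR invr_gt0 ltr0n.
have [phi [phi_homo phiP]] := filter_subsequence _ ooF FP.
exists phi; split=> //; exists (Holo fh f0).
apply: cwso_cvg => K U cK KO oU fU.
apply: (@compact_weakstar_near _ _ _ Omega (fun n => v (phi n)) f M d e oO M0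
  (fun n x => vM _ x) fM _ f_lip d_dense e_dense _ K U cK KO oU fU).
  move=> n q rho rho0 rO; exact: (locally_lipschitz oO (vh (phi n)) M0 (fun x _ => vM _ x)).
move=> i j; apply/cvgrPdist_lt => _ /gt0_complexP[eps eps0 ->].
near=> n.
(* From some rank on, the fixed pair [(i, j)] is among those that [P n] controls. *)
have ni : (i < n.+1)%N by near: n; exists i.
have nj : (j < n.+1)%N by near: n; exists j.
have := phiP n (Ordinal ni, Ordinal nj) => /= /lt_trans; apply.
by rewrite ltcR; near: n; exact: (near_infty_natSinv_lt (PosNum eps0)).
Unshelve. all: by end_near. Qed.
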